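(* For every integer $n\geq 1$ the following hold: $$H^1_d\left(\mathrm{SU}(n+1,1),C^\infty(S^{2n+1},\mathbb{R})\right)\neq\{0\},\qquad H^1_d\left(\mathrm{SO}(n+1,1),C^\infty(S^n,\mathbb{R})\right)\neq\{0\}.$$
   Context: $\mathrm{SU}(n+1,1)$ acts on $S^{2n+1}$ by its standard action by $CR$-automorphisms, i.e. its projective action on the set of complex isotropic lines of the Hermitian form of signature $(n+1,1)$ on $\mathbb{C}^{n+2}$. $\mathrm{SO}(n+1,1)$ acts on $S^n$ by its standard action by conformal automorphisms, i.e. its projective action on the set of real isotropic lines of the quadratic form of signature $(n+1,1)$ on $\mathbb{R}^{n+2}$. For a Lie group $G$ acting smoothly on $M$, $C^\infty(M,\mathbb{R})$ carries the $C^\infty$-topology and the $G$-action $(\alpha\cdot f)(x)=f(\alpha^{-1}x)$; it is a differentiable $G$-module. For a differentiable $G$-module $W$, $H^r_d(G,W)$ is the cohomology of the complex of smooth inhomogeneous cochains $C^\infty(G^r,W)$ with the coboundary $\partial^0(w)(\alpha)=\alpha\cdot w-w$ and $$\partial^r\lambda(\alpha_1,\dots,\alpha_{r+1})=\alpha_1\cdot\lambda(\alpha_2,\dots,\alpha_{r+1})+\sum_{i=1}^r(-1)^i\lambda(\alpha_1,\dots,\alpha_i\alpha_{i+1},\dots,\alpha_{r+1})+(-1)^{r+1}\lambda(\alpha_1,\dots,\alpha_r).$$ *)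

(* Defs.v *)
From HB Require Import structures.
From mathcomp Require Import all_boot all_order all_algebra.
From mathcomp Require Import complex.
From mathcomp Require Import all_classical all_reals all_analysis.
Import Order.TTheory GRing.Theory Num.Theory.
Import numFieldNormedType.Exports.

Set Implicit Arguments.
Unset Strict Implicit.
Unset Printing Implicit Defensive.

Local Open Scope classical_set_scope.
Local Open Scope ring_scope.

Section Smooth.
Context {R : realType} {E : normedModType R}.
Implicit Types (U : set E) (f : E -> R) (vs : seq E).

(* The derivative at [a] is taken along the vectors of [vs] from right to left. *)
Definition iterD f vs : E -> R := foldr (fun v g => 'D_v g) f vs.

(* On a finite-dimensional [E] and an open set [U], this is being C^oo on [U]. *)
Definition smooth_on U f :=
  forall vs a, U a -> differentiable (iterD f vs) a.

(* Smoothness of a map from an open subset of a finite-dimensional space to a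
   topological vector space: all iterated directional derivatives
   [D [:: v1; ...; vk]] exist as limits in [W] and are continuous. *)
Definition smooth_into (W : preTopologicalLmodType R) U (F : E -> W) :=
  exists D : seq E -> E -> W,
    (forall a, U a -> D [::] a = F a) /\
    (forall vs a, U a ->
       {for a, continuous (D vs)} /\
       forall v, (fun h : R => h^-1 *: (D vs (h *: v + a) - D vs a)) @ 0^'
                   --> D (v :: vs) a).

(* A set [X] is regarded as a subset of [E] through the injection [emb];
   smooth maps on [X] are those which extend locally to smooth maps on [E]. *)
Definition smooth_fun (X : Type) (emb : X -> E) (f : X -> R) :=
  forall p, exists U F, [/\ open U, U (emb p), smooth_on U F &
    forall q, U (emb q) -> F (emb q) = f q].

Definition smooth_map (X : Type) (emb : X -> E) (W : preTopologicalLmodType R)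
    (f : X -> W) :=
  forall p, exists U (F : E -> W), [/\ open U, U (emb p), smooth_into U F &
    forall q, U (emb q) -> F (emb q) = f q].

Lemma near_eq_differentiable f g a :
  (\near a, f a = g a) -> differentiable f a -> differentiable g a.
Proof.
move=> fg /diff_locallyP[cf Ef].
have fga : f a = g a by exact: nbhs_singleton fg.
have Eg : g \o shift a = cst (g a) + 'd f a +o_ 0 id.
  have fg0 : \forall h \near 0, f (h + a) = g (h + a).
    by move: fg; rewrite (near_shift 0 a) subr0.
  apply/eqaddoP => _/posnumP[e]; move/eqaddoP : Ef => /(_ _ [gt0 of e%:num]).
  apply: filter_app; near=> h; rewrite !fctE/= -fga.
  by have -> : f (h + a) = g (h + a) by near: h.
apply/diff_locallyP; rewrite (diff_unique cf Eg); split => //.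
Unshelve. all: by end_near. Qed.

Lemma smooth_onW U f : smooth_on U f -> forall a, U a -> differentiable f a.
Proof. by move=> sf a; exact: (sf [::]). Qed.

Lemma smooth_on_derive U f v : smooth_on U f -> smooth_on U ('D_v f).
Proof. by move=> sf vs a /(sf (rcons vs v)); rewrite /iterD foldr_rcons. Qed.

Lemma smooth_on_coind U (P : (E -> R) -> Prop) : open U ->
  (forall g, P g -> (forall a, U a -> differentiable g a) /\
    forall v, exists2 g', P g' & forall a, U a -> 'D_v g a = g' a) ->
  forall g, P g -> smooth_on U g.
Proof.
move=> oU Pstep g Pg.
have H vs : exists2 g', P g' & forall a, U a -> iterD g vs a = g' a.
  elim: vs => [|v vs [g' Pg' Eg]]; first by exists g.
  have [_ /(_ v)[g'' Pg'' Eg'']] := Pstep _ Pg'; exists g'' => // a Ua.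
  rewrite -Eg''//=; apply: near_eq_derive.
  by near=> b; apply: Eg; near: b; exact: open_nbhs_nbhs.
move=> vs a Ua; have [g' Pg' Eg] := H vs.
have [/(_ a Ua) dg' _] := Pstep _ Pg'.
apply: near_eq_differentiable dg'.
by near=> b; apply/esym/Eg; near: b; exact: open_nbhs_nbhs.
Unshelve. all: by end_near. Qed.

End Smooth.

Section Alg.
Context {R : realType}.

(* Functions built from smooth ones by the ring operations, inversion and
   composition; [smooth_algP] shows that they are smooth. *)
Inductive smooth_alg (E : normedModType R) (V : set E) : (E -> R) -> Prop :=
| smooth_alg_base f of smooth_on V f : smooth_alg V f
| smooth_algD f g of smooth_alg V f & smooth_alg V g : smooth_alg V (f \+ g)
| smooth_algM f g of smooth_alg V f & smooth_alg V g : smooth_alg V (f \* g)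
| smooth_algV f of smooth_alg V f & (forall a, V a -> f a != 0) :
    smooth_alg V (fun a => (f a)^-1)
| smooth_alg_comp N (U : set 'cV[R]_N) (f : 'cV[R]_N -> R) (phi : E -> 'cV[R]_N)
    of smooth_on U f & (forall a, V a -> U (phi a)) &
    (forall i, smooth_alg V (fun a => phi a i ord0)) :
    smooth_alg V (f \o phi).
End Alg.


Section AlgTheory.
Context {R : realType} {E : normedModType R}.
Implicit Types (V : set E) (f : E -> R).

Lemma smooth_cst V (c : R) : open V -> smooth_on V (cst c).
Proof.
move=> oV; apply: (@smooth_on_coind _ _ _ (fun g => exists c, g = cst c)) => //;
  last by exists c.
move=> _ [d ->]; split=> [a _|v]; first exact: differentiable_cst.
exists (cst 0); first by exists 0.
by move=> a _; rewrite derive_cst.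
Qed.

Lemma smooth_alg_cst V c : open V -> smooth_alg V (cst c).
Proof. by move=> oV; apply: smooth_alg_base; exact: smooth_cst. Qed.

Lemma smooth_alg_sum V n (h : 'I_n -> E -> R) : open V ->
  (forall i, smooth_alg V (h i)) -> smooth_alg V (fun x => \sum_i h i x).
Proof.
move=> oV hs; have -> : (fun x => \sum_i h i x) = \sum_i h i.
  by apply/funext => x; rewrite fct_sumE.
elim/big_ind : _ => //; first exact: smooth_alg_cst.
by move=> f g; exact: smooth_algD.
Qed.

Lemma differentiable_col N (phi : E -> 'cV[R]_N) a :
  (forall i, differentiable (fun x => phi x i ord0) a) -> differentiable phi a.
Proof.
move=> dphi.
have -> : phi = \sum_i (fun x => phi x i ord0 *: (delta_mx i ord0 : 'cV[R]_N)).
  apply/funext => x; rewrite fct_sumE [LHS]matrix_sum_delta.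
  by apply: eq_bigr => i _; rewrite big_ord1.
by apply: differentiable_sum => i; exact: differentiableZl.
Qed.

Lemma smooth_alg_step V g : open V -> smooth_alg V g ->
  (forall a, V a -> differentiable g a) /\
  forall v, exists2 g', smooth_alg V g' & forall a, V a -> 'D_v g a = g' a.
Proof.
move=> oV; elim=> {g}.
- move=> f sf; split=> [|v]; first exact: smooth_onW.
  by exists ('D_v f) => //; apply: smooth_alg_base; exact: smooth_on_derive.
- move=> f g sf [df Df] sg [dg Dg]; split=> [a Va|v].
    by apply: differentiableD; [exact: df|exact: dg].
  have [[f' sf' Ef] [g' sg' Eg]] := (Df v, Dg v).
  exists (f' \+ g'); first exact: smooth_algD.
  move=> a Va; rewrite deriveD; last 2 first.
    exact/diff_derivable/df.
    exact/diff_derivable/dg.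
  by rewrite Ef// Eg.
- move=> f g sf [df Df] sg [dg Dg]; split=> [a Va|v].
    by apply: differentiableM; [exact: df|exact: dg].
  have [[f' sf' Ef] [g' sg' Eg]] := (Df v, Dg v).
  exists ((f \* g') \+ (g \* f')).
    by apply: smooth_algD; exact: smooth_algM.
  move=> a Va; rewrite deriveM; last 2 first.
    exact/diff_derivable/df.
    exact/diff_derivable/dg.
  by rewrite Ef// Eg.
- move=> f sf [df Df] f0; split=> [a Va|v].
    by apply: differentiableV; [exact: df|exact: f0].
  have [f' sf' Ef] := Df v.
  exists ((cst (-1) \* ((fun a => (f a)^-1) \* (fun a => (f a)^-1))) \* f').
    apply: smooth_algM => //; apply: smooth_algM; first exact: smooth_alg_cst.
    by apply: smooth_algM; exact: smooth_algV.
  move=> a Va; rewrite deriveV; [|exact: f0|exact/diff_derivable/df].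
  by rewrite Ef//= expr2 invfM mulN1r.
- move=> N U f phi sf VU sphi IH.
  have dphi a : V a -> differentiable phi a.
    by move=> Va; apply: differentiable_col => i; have [+ _] := IH i; exact.
  have df a : V a -> differentiable f (phi a) by move=> /VU; exact: smooth_onW.
  split=> [a Va|v].
    by apply: differentiable_comp; [exact: dphi|exact: df].
  have /choice[phi' Hphi'] : forall i, exists g', smooth_alg V g' /\
      forall a, V a -> 'D_v (fun x => phi x i ord0) a = g' a.
    by move=> i; have [_ /(_ v)[g' ? ?]] := IH i; exists g'.
  exists (fun x => \sum_i ((phi' i) \*
      (('D_(delta_mx i ord0) f) \o phi)) x).
    apply: smooth_alg_sum => // i; apply: smooth_algM; first by case: (Hphi' i).
    by apply: (@smooth_alg_comp _ _ _ _ U) => //; exact: smooth_on_derive.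
  move=> a Va.
  rewrite deriveE; last by apply: differentiable_comp; [exact: dphi|exact: df].
  rewrite diff_comp; [|exact: dphi|exact: df].
  rewrite /= [X in 'd f _ X]matrix_sum_delta linear_sum/=.
  apply: eq_bigr => i _; rewrite big_ord1 linearZ/= -(@deriveE _ _ _ f _ _ (df _ Va)).
  congr (_ * _).
  have [_ <-//] := Hphi' i.
  rewrite deriveE; last by have [+ _] := IH i; exact.
  have -> : (fun x => phi x i ord0) = (fun M : 'cV[R]_N => M i ord0 : R) \o phi.
    by [].
  rewrite (diff_comp (dphi _ Va) (differentiable_coord _ _ _)).
  have lin : linear (fun M : 'cV[R]_N => M i ord0 : R^o).
    by move=> k x y; rewrite !mxE.
  pose lM := GRing.isLinear.Build _ _ _ _ _ lin.
  pose l : {linear 'cV[R]_N -> R^o} := HB.pack (fun M : 'cV[R]_N => M i ord0) lM.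
  have -> : (fun M : 'cV[R]_N => M i ord0 : R) = l by [].
  by rewrite diff_lin//; exact: coord_continuous.
Qed.

Lemma smooth_algP V f : open V -> smooth_alg V f -> smooth_on V f.
Proof.
move=> oV; apply: smooth_on_coind => // g; exact: smooth_alg_step.
Qed.

End AlgTheory.

Section Sphere.
Context (R : realType) (N : nat).

Record sphere := Sphere {
  sphere_val :> 'cV[R]_N;
  _ : \sum_i sphere_val i ord0 ^+ 2 == 1 }.
HB.instance Definition _ := [isSub for sphere_val].
HB.instance Definition _ := [Choice of sphere by <:].

Definition Cinf_pred : {pred (sphere -> R^o)} :=
  fun f => `[< smooth_fun sphere_val f >].

Lemma Cinf_submod : submod_closed Cinf_pred.
Proof.
split=> [|k f g /asboolP sf /asboolP sg]; apply/asboolP => p.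
  exists setT, (cst 0); split=> //; first exact: openT.
  exact/smooth_cst/openT.
have [U [F [oU Up sF Ff]]] := sf p; have [V [G [oV Vp sG Gg]]] := sg p.
exists (U `&` V), (fun x => k * F x + G x); split.
- exact: openI.
- by [].
- have oUV : open (U `&` V) by exact: openI.
  apply: smooth_algP => //; apply: (@smooth_algD _ _ _ (cst k \* F)).
    apply: smooth_algM; first exact: smooth_alg_cst.
    by apply: smooth_alg_base => vs a [Ua _]; exact: sF.
  by apply: smooth_alg_base => vs a [_ Va]; exact: sG.
- by move=> q [Uq Vq]; rewrite Ff// Gg.
Qed.

HB.instance Definition _ :=
  GRing.isSubmodClosed.Build R _ Cinf_pred Cinf_submod.

Record Cinf := MkCinf { Cinf_fun :> sphere -> R^o; _ : Cinf_fun \in Cinf_pred }.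
HB.instance Definition _ := [isSub for Cinf_fun].
HB.instance Definition _ := [Choice of Cinf by <:].
HB.instance Definition _ := [SubChoice_isSubLmodule of Cinf by <:].

(* The extension of [f] to [x |-> f (x / |x|)], set to 0 at the origin. *)
Definition radial (f : sphere -> R) (x : 'cV[R]_N) : R :=
  oapp f 0 (insub ((Num.sqrt (\sum_i x i ord0 ^+ 2))^-1 *: x)).

(* The C^oo-topology: uniform convergence on the sphere of every iterated
   directional derivative of the radial extension, which is smooth away from
   the origin when [f] is smooth; see [cvg_CinfP] below. *)
Definition jet (f : Cinf) :
    prod_topology (fun _ : seq 'cV[R]_N => {uniform sphere -> R}) :=
  fun vs p => iterD (radial f) vs p.

HB.instance Definition _ := Topological.copy Cinf (initial_topology jet).

Lemma cvg_CinfP (F : set_system Cinf) (f : Cinf) : Filter F ->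
  F --> f <-> forall vs, {uniform, (fun g : Cinf => jet g vs) @ F --> jet f vs}.
Proof.
move=> FF; split=> [Ff vs|H].
  have c : continuous (fun g : Cinf => jet g vs : {uniform sphere -> R}).
    move=> g; apply: (@continuous_comp _
        (prod_topology (fun _ : seq 'cV[R]_N => {uniform sphere -> R})) _
        jet (fun h => h vs)).
      exact: initial_continuous.
    exact: (@proj_continuous _ (fun=> {uniform sphere -> R}) vs).
  exact: cvg_comp Ff (c f).
have jc : jet @ F --> jet f.
  apply/cvg_sup => vs A /= [B [[C oC <-] Cf] BA].
  apply: (@filterS _ F _ ((fun g => jet g vs) @^-1` C)).
    by move=> g Cg; exact: BA.
  by apply: H; exact: open_nbhs_nbhs.
move=> A [B [[C oC <-] Cf] BA].
by apply: (filterS BA); apply: jc; exact: open_nbhs_nbhs.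
Qed.

Lemma smooth_fun_comp (f : Cinf) (s : sphere -> sphere) (V : set 'cV[R]_N)
    (phi : 'cV[R]_N -> 'cV[R]_N) : open V -> (forall p : sphere, V p) ->
  (forall p : sphere, phi p = s p) ->
  (forall i, smooth_alg V (fun x => phi x i ord0)) ->
  (f \o s : sphere -> R^o) \in Cinf_pred.
Proof.
move=> oV Vs phis sphi; apply/asboolP => p.
have : smooth_fun sphere_val f by apply/asboolP; case: f.
move=> /(_ (s p)) [U [F [oU Up sF Ff]]].
have phic x : V x -> {for x, continuous phi}.
  move=> Vx; apply/differentiable_continuous/differentiable_col => i.
  exact: (smooth_algP oV (sphi i) [::]).
have oVU : open (V `&` phi @^-1` U).
  rewrite openE => x [Vx Ux]; apply: filterI; first exact: open_nbhs_nbhs.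
  by apply: phic => //; exact: open_nbhs_nbhs.
exists (V `&` phi @^-1` U), (F \o phi); split => //.
- by split => //=; rewrite phis.
- apply: smooth_algP => //; apply: (@smooth_alg_comp _ _ _ _ U) => // [a [_]//|i].
  by apply: smooth_alg_base => vs a [Va _]; exact: (smooth_algP oV (sphi i)).
- by move=> q [_ /= Uq]; rewrite /= phis Ff// -phis.
Qed.

End Sphere.

Section SpecialIsometry.
Context (F : numFieldType) (c : {rmorphism F -> F}) (m : nat).

Definition Jform : 'M[F]_(m + 1) := block_mx 1%:M 0 0 (- 1%:M).

Definition adj p q (A : 'M[F]_(p, q)) : 'M[F]_(q, p) := (map_mx c A)^T.

(* The group of matrices of determinant 1 which preserve the form
   [|x_0|^2 + ... + |x_(m-1)|^2 - |x_m|^2], where [|x|^2 = c x * x]. *)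
Record siso := Siso {
  siso_val :> 'M[F]_(m + 1);
  _ : (adj siso_val *m Jform *m siso_val == Jform) && (\det siso_val == 1) }.
HB.instance Definition _ := [isSub for siso_val].
HB.instance Definition _ := [Choice of siso by <:].

Implicit Types g h : siso.

Lemma adjM p q r (A : 'M[F]_(p, q)) (B : 'M[F]_(q, r)) :
  adj (A *m B) = adj B *m adj A.
Proof. by rewrite /adj map_mxM trmx_mul. Qed.

Lemma adj1 p : adj (1%:M : 'M[F]_p) = 1%:M.
Proof. by rewrite /adj map_mx1 trmx1. Qed.

Lemma sisoJ g : adj g *m Jform *m g = Jform.
Proof. by case: g => ? /= /andP[/eqP]. Qed.

Lemma siso_det g : \det g = 1.
Proof. by case: g => ? /= /andP[_ /eqP]. Qed.

Lemma siso_unit g : (g : 'M[F]_(m + 1)) \in unitmx.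
Proof. by rewrite unitmxE siso_det unitr1. Qed.

Fact siso1_subproof :
  (adj 1%:M *m Jform *m 1%:M == Jform) && (\det (1%:M : 'M[F]_(m + 1)) == 1).
Proof. by rewrite adj1 mul1mx mulmx1 det1 !eqxx. Qed.

Fact sisoM_subproof g h :
  (adj (g *m h) *m Jform *m (g *m h) == Jform) && (\det (g *m h) == 1).
Proof.
rewrite adjM -!mulmxA (mulmxA Jform) (mulmxA (adj g)) (mulmxA (adj g)) sisoJ.
by rewrite mulmxA sisoJ det_mulmx !siso_det mulr1 !eqxx.
Qed.

Fact sisoV_subproof g :
  (adj (invmx g) *m Jform *m invmx g == Jform) && (\det (invmx g) == 1).
Proof.
rewrite det_inv siso_det invr1 eqxx andbT -{1}(sisoJ g) !mulmxA -adjM.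
by rewrite mulmxV ?siso_unit// adj1 mul1mx -mulmxA mulmxV ?siso_unit// mulmx1.
Qed.

Definition siso1 := Siso siso1_subproof.
Definition sisoM g h := Siso (sisoM_subproof g h).
Definition sisoV g := Siso (sisoV_subproof g).

Fact sisoA : associative sisoM.
Proof. by move=> g h k; apply/val_inj; exact: mulmxA. Qed.
Fact siso1M : left_id siso1 sisoM.
Proof. by move=> g; apply/val_inj; exact: mul1mx. Qed.
Fact sisoM1 : right_id siso1 sisoM.
Proof. by move=> g; apply/val_inj; exact: mulmx1. Qed.
Fact sisoVM : left_inverse siso1 sisoV sisoM.
Proof. by move=> g; apply/val_inj; exact: (mulVmx (siso_unit g)). Qed.
Fact sisoMV : right_inverse siso1 sisoV sisoM.
Proof. by move=> g; apply/val_inj; exact: (mulmxV (siso_unit g)). Qed.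

HB.instance Definition _ := isGroup.Build siso sisoA siso1M sisoM1 sisoVM sisoMV.

(* A point [v] of the unit sphere stands for the isotropic line through
   [(v, 1)], and the projective action maps it to the line through [g (v, 1)]. *)
Definition lift1 (v : 'cV[F]_m) : 'cV[F]_(m + 1) := col_mx v 1%:M.
Definition last_coord (g : 'M[F]_(m + 1)) (v : 'cV[F]_m) : F :=
  dsubmx (g *m lift1 v) ord0 ord0.
Definition proj_act (g : 'M[F]_(m + 1)) (v : 'cV[F]_m) : 'cV[F]_m :=
  (last_coord g v)^-1 *: usubmx (g *m lift1 v).

Hypothesis cE : forall x : F, c x * x = `|x| ^+ 2.

Lemma adj_sqE p (v : 'cV[F]_p) : (adj v *m v) = (\sum_i `|v i ord0| ^+ 2)%:M.
Proof.
apply/matrixP => i j; rewrite !ord1 !mxE eqxx mulr1n.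
by apply: eq_bigr => k _; rewrite !mxE cE.
Qed.

Lemma JformE (u : 'cV[F]_m) (t : 'cV[F]_1) :
  adj (col_mx u t) *m Jform *m col_mx u t = adj u *m u - adj t *m t.
Proof.
rewrite /adj map_col_mx tr_col_mx mul_row_block mul_row_col.
by rewrite !mulmx0 mulmxN !mulmx1 addr0 add0r mulNmx.
Qed.

Lemma proj_act_sphere g (v : 'cV[F]_m) : \sum_i `|v i ord0| ^+ 2 = 1 ->
  last_coord g v != 0 /\ \sum_i `|proj_act g v i ord0| ^+ 2 = 1.
Proof.
move=> v1; set u := usubmx (g *m lift1 v); set t := dsubmx (g *m lift1 v).
have gE : g *m lift1 v = col_mx u t by rewrite vsubmxK.
have H : adj u *m u = adj t *m t.
  apply/eqP; rewrite -subr_eq0 -JformE -gE adjM -!mulmxA.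
  rewrite (mulmxA Jform) (mulmxA (adj g)) (mulmxA (adj g)) sisoJ mulmxA.
  by rewrite JformE adj1 mulmx1 adj_sqE v1 subrr.
move: H; rewrite !adj_sqE big_ord1 => /matrixP /(_ ord0 ord0).
rewrite [LHS]mxE [RHS]mxE /= !mulr1n -/(last_coord g v) => H.
have t0 : last_coord g v != 0.
  apply/eqP => t0; move: H; rewrite t0 normr0 expr0n => /eqP.
  rewrite psumr_eq0 => [/allP u0|i _]; last exact: exprn_ge0.
  have uz : u = 0.
    apply/matrixP => i j; rewrite ord1 [RHS]mxE.
    have /eqP := u0 i (mem_index_enum i).
    by move/eqP; rewrite expf_eq0/= normr_eq0 => /eqP.
  have tz : t = 0 by apply/matrixP => i j; rewrite !ord1 [RHS]mxE.
  have : lift1 v = 0.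
    by rewrite -(mulKmx (siso_unit g) (lift1 v)) gE uz tz col_mx0 mulmx0.
  move=> /(congr1 dsubmx); rewrite /lift1 col_mxKd => /matrixP /(_ ord0 ord0).
  by rewrite !mxE eqxx => /eqP; rewrite oner_eq0.
split=> //.
under eq_bigr => i _ do rewrite mxE normrM exprMn.
by rewrite -mulr_sumr H -exprMn -normrM mulVf// normr1 expr1n.
Qed.

Lemma proj_actM (g h : 'M[F]_(m + 1)) v : last_coord h v != 0 ->
  proj_act (g *m h) v = proj_act g (proj_act h v).
Proof.
move=> t0.
have lE : lift1 (proj_act h v) = (last_coord h v)^-1 *: (h *m lift1 v).
  rewrite -[h *m lift1 v]vsubmxK scale_col_mx; congr col_mx.
  by apply/matrixP => i j; rewrite !ord1 [RHS]mxE mxE eqxx mulVf.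
have lastE : last_coord g (proj_act h v) =
    (last_coord h v)^-1 * last_coord (g *m h) v.
  by rewrite {1}/last_coord lE -scalemxAr mulmxA linearZ/= [LHS]mxE.
rewrite [RHS]/proj_act lastE lE -scalemxAr mulmxA linearZ/=.
by rewrite scalerA invfM invrK mulrAC divff// mul1r.
Qed.

Lemma proj_act1 v : proj_act 1%:M v = v.
Proof.
by rewrite /proj_act /last_coord mul1mx col_mxKd mxE eqxx invr1 scale1r col_mxKu.
Qed.

End SpecialIsometry.

Section SmoothEntries.
Context {R : realType} {E : normedModType R}.

Lemma smooth_coord N (V : set 'cV[R]_N) i : open V ->
  smooth_on V (fun x => x i ord0).
Proof.
move=> oV; pose P (g : 'cV[R]_N -> R) :=
  g = (fun x => x i ord0) \/ exists c, g = cst c.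
apply: (@smooth_on_coind _ _ _ P) => //; last by left.
move=> _ [->|[c ->]]; split=> [a _|v].
- exact: differentiable_coord.
- exists (cst (v i ord0)); first by right; exists (v i ord0).
  have lin : linear (fun M : 'cV[R]_N => M i ord0 : R^o).
    by move=> k x y; rewrite !mxE.
  pose lM := GRing.isLinear.Build _ _ _ _ _ lin.
  pose l : {linear 'cV[R]_N -> R^o} := HB.pack (fun M : 'cV[R]_N => M i ord0) lM.
  have -> : (fun M : 'cV[R]_N => M i ord0 : R) = l by [].
  move=> a _; rewrite deriveE; last exact: differentiable_coord.
  by rewrite diff_lin//; exact: coord_continuous.
- exact: differentiable_cst.
- by exists (cst 0); [right; exists 0|move=> a _; rewrite derive_cst].
Qed.

Lemma smooth_alg_sub (U V : set E) f : open U -> V `<=` U ->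
  smooth_alg U f -> smooth_alg V f.
Proof.
by move=> oU VU /(smooth_algP oU) sf; apply: smooth_alg_base => vs a /VU; exact: sf.
Qed.

Lemma smooth_alg_neq0 (f : E -> R) : smooth_alg setT f -> open [set x | f x != 0].
Proof.
move=> /(smooth_algP openT) sf; rewrite openE => x /= fx0.
have fc : {for x, continuous f}.
  exact/differentiable_continuous/(sf [::]).
have /fc : nbhs (f x) [set y | y != 0].
  by apply: open_nbhs_nbhs; split => //; exact: open_neq.
by [].
Qed.

(* Complex-valued functions with real and imaginary parts in [smooth_alg]. *)
Definition csmooth_alg (V : set E) (f : E -> R[i]) :=
  smooth_alg V (fun x => complex.Re (f x)) /\
  smooth_alg V (fun x => complex.Im (f x)).

Variable V : set E.
Hypothesis oV : open V.

Lemma csmooth_alg_cst c : csmooth_alg V (cst c).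
Proof. by split; exact: smooth_alg_cst. Qed.

Lemma csmooth_algD f g : csmooth_alg V f -> csmooth_alg V g ->
  csmooth_alg V (f \+ g).
Proof.
move=> [rf jf] [rg jg]; split.
- have -> : (fun x => complex.Re ((f \+ g) x)) =
    (fun x => complex.Re (f x)) \+ (fun x => complex.Re (g x)).
    by apply/funext => x /=; case: (f x) (g x) => [? ?] [? ?].
  exact: smooth_algD.
- have -> : (fun x => complex.Im ((f \+ g) x)) =
    (fun x => complex.Im (f x)) \+ (fun x => complex.Im (g x)).
    by apply/funext => x /=; case: (f x) (g x) => [? ?] [? ?].
  exact: smooth_algD.
Qed.

Lemma csmooth_algM f g : csmooth_alg V f -> csmooth_alg V g ->
  csmooth_alg V (f \* g).
Proof.
move=> [rf jf] [rg jg]; split.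
- have -> : (fun x => complex.Re ((f \* g) x)) =
    ((fun x => complex.Re (f x)) \* (fun x => complex.Re (g x))) \+
    (cst (-1) \* ((fun x => complex.Im (f x)) \* (fun x => complex.Im (g x)))).
    by apply/funext => x /=; case: (f x) (g x) => [? ?] [? ?] /=; rewrite mulN1r.
  apply: smooth_algD; first exact: smooth_algM.
  by apply: smooth_algM; [exact: smooth_alg_cst|exact: smooth_algM].
- have -> : (fun x => complex.Im ((f \* g) x)) =
    ((fun x => complex.Re (f x)) \* (fun x => complex.Im (g x))) \+
    ((fun x => complex.Im (f x)) \* (fun x => complex.Re (g x))).
    by apply/funext => x /=; case: (f x) (g x) => [? ?] [? ?].
  by apply: smooth_algD; exact: smooth_algM.
Qed.

Definition sqmod (z : R[i]) : R :=
  complex.Re z * complex.Re z + complex.Im z * complex.Im z.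

Lemma sqmod_neq0 z : (sqmod z != 0) = (z != 0).
Proof.
case: z => a b; rewrite eq_complex/= /sqmod/= -!expr2.
by rewrite paddr_eq0 ?sqr_ge0// !sqrf_eq0.
Qed.

Lemma smooth_alg_sqmod f : csmooth_alg V f -> smooth_alg V (fun x => sqmod (f x)).
Proof.
move=> [rf jf].
apply: (@smooth_algD _ _ _ (fun x => complex.Re (f x) * complex.Re (f x)));
  exact: smooth_algM.
Qed.

Lemma csmooth_algV f : csmooth_alg V f -> (forall a, V a -> f a != 0) ->
  csmooth_alg V (fun x => (f x)^-1).
Proof.
move=> sf f0; have [rf jf] := sf.
have si : smooth_alg V (fun x => (sqmod (f x))^-1).
  by apply: smooth_algV; [exact: smooth_alg_sqmod|move=> a /f0; rewrite sqmod_neq0].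
split.
- have -> : (fun x => complex.Re (f x)^-1) =
    (fun x => complex.Re (f x)) \* (fun x => (sqmod (f x))^-1).
    by apply/funext => x /=; case: (f x).
  exact: smooth_algM.
- have -> : (fun x => complex.Im (f x)^-1) =
    cst (-1) \* ((fun x => complex.Im (f x)) \* (fun x => (sqmod (f x))^-1)).
    by apply/funext => x /=; case: (f x) => a b /=; rewrite mulN1r.
  by apply: smooth_algM; [exact: smooth_alg_cst|exact: smooth_algM].
Qed.

End SmoothEntries.

Lemma entry_lift1 (T : Type) (F : numFieldType) (A : (T -> F) -> Prop) (m : nat)
    (g : 'M[F]_(m + 1)) (v : T -> 'cV[F]_m) :
  (forall a, A (cst a)) ->
  (forall f h, A f -> A h -> A (f \+ h)) ->
  (forall f h, A f -> A h -> A (f \* h)) ->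
  (forall i, A (fun x => v x i ord0)) ->
  forall k, A (fun x => (g *m lift1 (v x)) k ord0).
Proof.
move=> Acst AD AM Av k.
have Al j : A (fun x => lift1 (v x) j ord0).
  rewrite /lift1 -(splitK j); case: (fintype.split j) => i /=.
    have -> : (fun x => col_mx (v x) 1%:M (lshift 1 i) ord0) =
      (fun x => v x i ord0) by apply/funext => x; rewrite col_mxEu.
    exact: Av.
  have -> : (fun x => col_mx (v x) 1%:M (rshift m i) ord0) =
    cst ((1%:M : 'M[F]_1) i ord0) by apply/funext => x; rewrite col_mxEd.
  exact: Acst.
have -> : (fun x => (g *m lift1 (v x)) k ord0) =
    \sum_j (cst (g k j) \* (fun x => lift1 (v x) j ord0)).
  by apply/funext => x; rewrite fct_sumE !mxE.
elim/big_ind : _ => [|f h|j _]; [exact: Acst|exact: AD|].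
by apply: AM.
Qed.

Section Actions.
Context (R : realType) (m : nat).

(* SO(m,1), over the reals with trivial conjugation, and SU(m,1). *)
Definition SO := siso (idfun : {rmorphism R -> R}) m.
Definition SU := siso (@conjc R : {rmorphism R[i] -> R[i]}) m.
HB.instance Definition _ := Group.on SO.
HB.instance Definition _ := Group.on SU.

Fact idfunE (x : R) : (idfun : {rmorphism R -> R}) x * x = `|x| ^+ 2.
Proof. by rewrite real_normK ?num_real// expr2. Qed.

Fact conjcE (x : R[i]) : (@conjc R : {rmorphism R[i] -> R[i]}) x * x = `|x| ^+ 2.
Proof. by rewrite mulrC -sqr_normc. Qed.

Lemma sphere_norm (p : sphere R m) : \sum_i `|p i ord0| ^+ 2 = 1.
Proof.
case: p => x /= /eqP <-; apply: eq_bigr => i _.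
by rewrite real_normK ?num_real.
Qed.

Fact SO_act_subproof (g : SO) (p : sphere R m) :
  \sum_i proj_act g p i ord0 ^+ 2 == 1.
Proof.
have [_ /eqP] := proj_act_sphere idfunE g (sphere_norm p); apply: etrans; congr (_ == _).
by apply: eq_bigr => i _; rewrite real_normK ?num_real.
Qed.

Definition SO_act (g : SO) (p : sphere R m) : sphere R m :=
  Sphere (SO_act_subproof g p).

(* S^(2m-1) lies in R^(m + m) = C^m, the first block of coordinates being the
   real parts. *)
Definition cplx (x : 'cV[R]_(m + m)) : 'cV[R[i]]_m :=
  \col_i (x (lshift m i) ord0 +i* x (rshift m i) ord0)%C.
Definition uncplx (z : 'cV[R[i]]_m) : 'cV[R]_(m + m) :=
  col_mx (map_mx (@complex.Re R) z) (map_mx (@complex.Im R) z).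

Lemma cplx_sum x : \sum_i `|cplx x i ord0| ^+ 2 = ((\sum_i x i ord0 ^+ 2)%:C)%C.
Proof.
rewrite big_split_ord/= rmorphD !rmorph_sum -big_split/=.
apply: eq_bigr => i _; rewrite mxE -conjcE; apply/eqP.
by rewrite eq_complex/= !expr2 !mulNr opprK addr0 eqxx/= [_ * x _ _]mulrC subrr.
Qed.

Lemma uncplxK : cancel uncplx cplx.
Proof.
move=> z; apply/colP => i; rewrite mxE col_mxEu col_mxEd !mxE.
by case: (z i ord0).
Qed.

Lemma cplx_sphere (p : sphere R (m + m)) : \sum_i `|cplx p i ord0| ^+ 2 = 1.
Proof. by rewrite cplx_sum; case: p => x /= /eqP ->. Qed.

Fact SU_act_subproof (g : SU) (p : sphere R (m + m)) :
  \sum_i uncplx (proj_act g (cplx p)) i ord0 ^+ 2 == 1.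
Proof.
have [_ ] := proj_act_sphere conjcE g (cplx_sphere p).
by rewrite -{1}(uncplxK (proj_act g (cplx p))) cplx_sum => -[->].
Qed.

Definition SU_act (g : SU) (p : sphere R (m + m)) : sphere R (m + m) :=
  Sphere (SU_act_subproof g p).

Fact SO_Cinf_subproof (g : SO) (f : Cinf R m) :
  (f \o SO_act (g^-1)%g : sphere R m -> R^o) \in @Cinf_pred R m.
Proof.
set h : 'M[R]_(m + 1) := (g^-1)%g : SO.
have se (V : set 'cV[R]_m) k : open V ->
    smooth_alg V (fun x => (h *m lift1 x) k ord0).
  move=> oV; apply: (@entry_lift1 _ _ (@smooth_alg R _ V) _ h id) => //.
  - by move=> a; exact: smooth_alg_cst.
  - by move=> ? ?; exact: smooth_algD.
  - by move=> ? ?; exact: smooth_algM.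
  - by move=> i; apply: smooth_alg_base; exact: smooth_coord.
have lE : last_coord h = fun x => (h *m lift1 x) (rshift m ord0) ord0.
  by apply/funext => x; rewrite /last_coord mxE.
pose V := [set x | last_coord h x != 0].
have oV : open V.
  by apply: smooth_alg_neq0; rewrite lE; apply: se; exact: openT.
apply: (@smooth_fun_comp _ _ f (SO_act (g^-1)%g) _ (proj_act h) oV) => //.
- by move=> p; exact: (proj_act_sphere idfunE (g^-1)%g (sphere_norm p)).1.
- move=> i.
  have -> : (fun x => proj_act h x i ord0) =
      (fun x => (last_coord h x)^-1) \*
      (fun x => (h *m lift1 x) (lshift 1 i) ord0).
    by apply/funext => x; rewrite mxE; congr (_ * _); rewrite mxE.
  apply: smooth_algM; last exact: se.
  by apply: smooth_algV => //; rewrite lE; exact: se.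
Qed.

Fact SU_Cinf_subproof (g : SU) (f : Cinf R (m + m)) :
  (f \o SU_act (g^-1)%g : sphere R (m + m) -> R^o) \in @Cinf_pred R (m + m).
Proof.
set h : 'M[R[i]]_(m + 1) := (g^-1)%g : SU.
have se (V : set 'cV[R]_(m + m)) k : open V ->
    csmooth_alg V (fun x => (h *m lift1 (cplx x)) k ord0).
  move=> oV; apply: (@entry_lift1 _ _ (@csmooth_alg R _ V) _ h cplx) => //.
  - by move=> a; exact: csmooth_alg_cst.
  - by move=> ? ?; exact: csmooth_algD.
  - by move=> ? ?; exact: csmooth_algM.
  - move=> i; split.
    + have -> : (fun x => complex.Re (cplx x i ord0)) =
        (fun x => x (lshift m i) ord0) by apply/funext => x; rewrite mxE.
      by apply: smooth_alg_base; exact: smooth_coord.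
    + have -> : (fun x => complex.Im (cplx x i ord0)) =
        (fun x => x (rshift m i) ord0) by apply/funext => x; rewrite mxE.
      by apply: smooth_alg_base; exact: smooth_coord.
have lE : last_coord h \o cplx =
    fun x => (h *m lift1 (cplx x)) (rshift m ord0) ord0.
  by apply/funext => x; rewrite /= /last_coord mxE.
pose V := [set x | sqmod (last_coord h (cplx x)) != 0].
have oV : open V.
  apply: smooth_alg_neq0; apply: (smooth_alg_sqmod (f := last_coord h \o cplx)).
  by rewrite lE; apply: se; exact: openT.
have sp i : csmooth_alg V (fun x => proj_act h (cplx x) i ord0).
  have -> : (fun x => proj_act h (cplx x) i ord0) =
      (fun x => ((last_coord h \o cplx) x)^-1) \*
      (fun x => (h *m lift1 (cplx x)) (lshift 1 i) ord0).
    by apply/funext => x; rewrite mxE; congr (_ * _); rewrite mxE.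
  apply: csmooth_algM => //; last exact: se.
  apply: csmooth_algV => //; first by rewrite lE; exact: se.
  by move=> a; rewrite /V/= sqmod_neq0.
apply: (@smooth_fun_comp _ _ f (SU_act (g^-1)%g) _
  (fun x => uncplx (proj_act h (cplx x))) oV) => //.
- move=> p; rewrite /V/= sqmod_neq0.
  exact: (proj_act_sphere conjcE (g^-1)%g (cplx_sphere p)).1.
- move=> i; rewrite -(splitK i); case: (fintype.split i) => j /=.
  + have -> : (fun x => uncplx (proj_act h (cplx x)) (lshift m j) ord0) =
      fun x => complex.Re (proj_act h (cplx x) j ord0).
      by apply/funext => x; rewrite /uncplx col_mxEu mxE.
    by have [] := sp j.
  + have -> : (fun x => uncplx (proj_act h (cplx x)) (rshift m j) ord0) =
      fun x => complex.Im (proj_act h (cplx x) j ord0).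
      by apply/funext => x; rewrite /uncplx col_mxEd mxE.
    by have [] := sp j.
Qed.

(* The actions [(g . f) p = f (g^-1 . p)] on smooth functions. *)
Definition SO_Cinf (g : SO) (f : Cinf R m) : Cinf R m :=
  MkCinf (SO_Cinf_subproof g f).

Definition SU_Cinf (g : SU) (f : Cinf R (m + m)) : Cinf R (m + m) :=
  MkCinf (SU_Cinf_subproof g f).

Lemma SO_CinfM g h f : SO_Cinf (g * h)%g f = SO_Cinf g (SO_Cinf h f).
Proof.
apply/val_inj/funext => p.
suff E : SO_act (g * h)^-1%g p = SO_act h^-1%g (SO_act g^-1%g p).
  exact: (congr1 f E).
have -> : ((g * h)^-1)%g = (h^-1 * g^-1)%g by exact: invgM.
apply/val_inj; apply: proj_actM.
by apply: (proj_act_sphere idfunE (g^-1)%g _).1; exact: sphere_norm.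
Qed.

Lemma SU_CinfM g h f : SU_Cinf (g * h)%g f = SU_Cinf g (SU_Cinf h f).
Proof.
apply/val_inj/funext => p.
suff E : SU_act (g * h)^-1%g p = SU_act h^-1%g (SU_act g^-1%g p).
  exact: (congr1 f E).
have -> : ((g * h)^-1)%g = (h^-1 * g^-1)%g by exact: invgM.
apply/val_inj; rewrite /= uncplxK; congr uncplx; apply: proj_actM.
exact: (proj_act_sphere conjcE (g^-1)%g (cplx_sphere p)).1.
Qed.

(* The Lie group structures are those of submanifolds of the real vector spaces
   of real, respectively complex, matrices. *)
Definition SO_emb (g : SO) : 'rV[R]_((m + 1) * (m + 1)) := mxvec g.

Definition SU_emb (g : SU) : 'rV[R]_((m + 1) * ((m + 1) + (m + 1))) :=
  mxvec (row_mx (map_mx (@complex.Re R) g) (map_mx (@complex.Im R) g)).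

End Actions.

Section Cohomology.
Context (R : realType) (d : nat) (G : groupType) (emb : G -> 'rV[R]_d).
Context (W : preTopologicalLmodType R) (act : G -> W -> W).

Definition cochain r := ('I_r -> G) -> W.

Definition emb_pow r (a : 'I_r -> G) : 'M[R]_(r, d) :=
  \matrix_(i, j) emb (a i) ord0 j.

Definition smooth_cochain r : set (cochain r) :=
  [set l | smooth_map (@emb_pow r) l].

Definition drop_last r (a : 'I_r.+1 -> G) : 'I_r -> G :=
  fun j => a (widen_ord (leqnSn r) j).

Definition drop_first r (a : 'I_r.+1 -> G) : 'I_r -> G := fun j => a (lift ord0 j).

(* With indices starting from 0, [a_i] and [a_(i+1)] are replaced by their
   product. *)
Definition merge r (i : 'I_r) (a : 'I_r.+1 -> G) : 'I_r -> G := fun j =>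
  if (j < i)%N then drop_last a j
  else if j == i then (drop_last a j * drop_first a j)%g else drop_first a j.

Definition cobound r (l : cochain r) : cochain r.+1 := fun a =>
  act (a ord0) (l (drop_first a)) + \sum_(i < r) (-1) ^+ i.+1 *: l (merge i a)
  + (-1) ^+ r.+1 *: l (drop_last a).

Definition cocycles r : set (cochain r) :=
  [set l | smooth_cochain l /\ cobound l = cst 0].

Definition coboundaries r : set (cochain r) :=
  match r with
  | 0 => [set cst 0]
  | s.+1 => [set cobound l | l in smooth_cochain (r := s)]
  end.

(* The quotient of cocycles by coboundaries, as the set of cosets; its zero is
   the coset [coboundaries r]. *)
Definition Hd r : set (set (cochain r)) :=
  [set [set l \+ b | b in coboundaries (r := r)] | l in cocycles (r := r)].

End Cohomology.

(* Main.v *)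
From HB Require Import structures.
From mathcomp Require Import all_boot all_order all_algebra.
From mathcomp Require Import complex ring lra.
From mathcomp Require Import all_classical all_reals all_analysis.
Require Import Defs.
Import Order.TTheory GRing.Theory Num.Theory.
Import numFieldNormedType.Exports.

(* The logarithm of the conformal factor is a cocycle. If [(p, 1)] spans an
   isotropic line, then [g^-1 (p, 1) = t (g^-1 p, 1)] for a nonzero scalar
   [t = t(g, p)], and [t] is multiplicative: [t(gh, p) = t(h, g^-1 p) t(g, p)].
   So [l(g) p = ln |t(g, p)|^2] is a 1-cocycle. A coboundary [g w - w] vanishes
   at [(k, p)] as soon as [k^-1 p = p], whereas a Lorentz boost [k^-1] fixes a
   point [p] of the sphere at which [t(k, p) = 4].

   For smoothness, [g^-1 = J g^* J] makes [t] affine in [p] and real-linear in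
   the entries of [g], so that [l] extends to a neighbourhood of the group in
   the space of matrices. That a function [f(a, x)] smooth in both variables is
   smooth as a map [a |-> f(a, _)] to C^oo of the sphere rests on the
   compactness of the sphere, the mean value theorem and the symmetry of second
   derivatives. *)

Set Implicit Arguments.
Unset Strict Implicit.
Unset Printing Implicit Defensive.

Local Open Scope classical_set_scope.
Local Open Scope ring_scope.

(** * Symmetry of second derivatives *)

Section Schwarz.
Context {R : realType} {E : normedModType R}.
Implicit Types (U : set E) (f : E -> R) (v w : E).

(** The difference quotient of [f] along [w] at [s *: w + a] is literally that of the one-variable
    function at [s], so the real mean value theorem applies along lines. *)
Lemma is_derive_line f a w (s : R) : differentiable f (s *: w + a) ->
  is_derive s 1 (fun t : R => f (t *: w + a)) ('D_w f (s *: w + a)).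
Proof.
move=> df; have [dw] : is_derive (s *: w + a) w f ('D_w f (s *: w + a)).
  by apply: DeriveDef => //; exact: diff_derivable.
have EE : (fun h : R => h^-1 *: (f (h *: w + (s *: w + a)) - f (s *: w + a))) =
  (fun h : R => h^-1 *: (f ((h *: (1 : R) + s) *: w + a) - f (s *: w + a))).
  by apply/funext => h; rewrite scalerDl addrA [h *: 1]mulr1.
move=> _; apply: DeriveDef; first by rewrite /derivable /= -EE.
by rewrite /derive /= -EE.
Qed.

Lemma MVT_line f a w :
  (forall s : R, s \in `[0, 1] -> differentiable f (s *: w + a)) ->
  exists2 s : R, s \in `[0, 1] & f (w + a) - f a = 'D_w f (s *: w + a).
Proof.
move=> df.
have cf : {within `[0, 1], continuous (fun t : R => f (t *: w + a))}.
  apply: derivable_within_continuous => s sI.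
  exact: (@ex_derive _ _ _ _ _ _ _ (is_derive_line (df s sI))).
have dl (s : R) : s \in `]0, 1[%R ->
    is_derive s 1 (fun t : R => f (t *: w + a)) ('D_w f (s *: w + a)).
  by move=> sI; apply/is_derive_line/df; exact: subset_itv_oo_cc.
have [s sI E1] := MVT_segment ler01 dl cf.
by exists s => //; move: E1; rewrite scale1r scale0r add0r subr0 mulr1.
Qed.

Lemma smooth_on_scale_derive U f (k : R) v : smooth_on U f ->
  forall a, U a -> 'D_(k *: v) f a = k * 'D_v f a.
Proof.
move=> sf a Ua; have da := smooth_onW sf Ua.
by rewrite !deriveE// linearZ.
Qed.

(* The left-hand side is symmetric in [v] and [w], whence [deriveC]. *)
Lemma second_difference U f a v w : smooth_on U f ->
  (forall s t : R, s \in `[0, 1] -> t \in `[0, 1] ->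
     U (t *: w + (s *: v + a))) ->
  exists s t : R, [/\ s \in `[0, 1], t \in `[0, 1] &
    f (w + (v + a)) - f (v + a) - (f (w + a) - f a) =
    'D_w ('D_v f) (t *: w + (s *: v + a))].
Proof.
move=> sf sU.
have I0 : (0 : R) \in `[0, 1] by rewrite in_itv/= lexx ler01.
have I1 : (1 : R) \in `[0, 1] by rewrite in_itv/= lexx ler01.
have U0 (s : R) : s \in `[0, 1] -> U (s *: v + a).
  by move=> sI; have := sU s 0 sI I0; rewrite scale0r add0r.
have U1 (s : R) : s \in `[0, 1] -> U (s *: v + a + w).
  by move=> sI; have := sU s 1 sI I1; rewrite scale1r addrC.
have dsh b : U (b + w) -> is_derive b v (fun x => f (x + w)) ('D_v f (b + w)).
  move=> Ub; have dv : derivable f (b + w) v.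
    exact/diff_derivable/(smooth_onW sf).
  have E1 : (fun h : R => h^-1 *: (f (h *: v + (b + w)) - f (b + w))) =
    (fun h : R => h^-1 *: (f (h *: v + b + w) - f (b + w))).
    by apply/funext => h; rewrite addrA.
  by apply: DeriveDef; rewrite /derivable /derive -E1.
(* The mean value theorem is used twice: for [g] along [v], which gives [s], then for ['D_v f] along
   [w], which gives [t]. *)
pose g x := f (x + w) - f x.
have dg b : U b -> U (b + w) -> differentiable g b.
  move=> Ub Ubw; apply: differentiableB; last exact: smooth_onW sf _ Ub.
  apply: (@differentiable_comp _ _ _ _ (fun x => x + w) f);
    last exact: smooth_onW sf _ Ubw.
  by apply: differentiableD.
have [|s sI] := @MVT_line g a v.
  by move=> s sI; apply: dg; [exact: U0|exact: U1].
rewrite /g deriveB; last 2 first.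
- exact: (@ex_derive _ _ _ _ _ _ _ (dsh _ (U1 _ sI))).
- exact/diff_derivable/(smooth_onW sf)/U0.
rewrite (@derive_val _ _ _ _ _ _ _ (dsh _ (U1 _ sI))) => E1.
have [|t tI] := @MVT_line ('D_v f) (s *: v + a) w.
  by move=> t tI; apply: (smooth_onW (smooth_on_derive v sf)); exact: sU.
move=> E2; exists s, t; split => //.
by rewrite -E2 !(addrC w) E1.
Qed.

Lemma ball_parallelogram (a v w : E) (r : R) : 0 < r ->
  \forall h \near (0 : R), forall s t : R, s \in `[0, 1] -> t \in `[0, 1] ->
    ball a r (t *: (h *: w) + (s *: (h *: v) + a)).
Proof.
(* The summand 1 keeps the divisor positive even when [v] and [w] are both 0. *)
move=> r0; have c0 : 0 < `|v| + `|w| + 1 by rewrite ltr_wpDl// addr_ge0.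
have d0 : \forall h \near (0 : R), `|h| < r / (`|v| + `|w| + 1).
  by apply: nbhs0_lt; rewrite divr_gt0.
near=> h => s t /itvP sI /itvP tI.
rewrite -ball_normE/= opprD addrA addrC opprD addrA addrNK -opprD normrN.
apply: (le_lt_trans (ler_normD _ _)).
rewrite !normrZ.
apply: (@le_lt_trans _ _ (`|h| * (`|v| + `|w|))).
  by rewrite mulrDr lerD// ler_piMl ?mulr_ge0// ger0_norm ?sI ?tI.
apply: (@le_lt_trans _ _ (`|h| * (`|v| + `|w| + 1))).
  by rewrite ler_wpM2l// lerDl.
rewrite -ltr_pdivlMr//.
by near: h.
Unshelve. all: by end_near. Qed.

(** The second difference over a parallelogram of size [h] is [h ^+ 2] times a second derivative at
    one of its points, which tends to [a] with [h]; continuity at [a] bounds the error. *)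
Lemma second_difference_approx U f a v w (e : R) : open U -> smooth_on U f ->
  U a -> 0 < e -> \forall h \near (0 : R),
  `|f (h *: w + (h *: v + a)) - f (h *: v + a) - (f (h *: w + a) - f a) -
    h ^+ 2 * 'D_w ('D_v f) a| <= h ^+ 2 * e.
Proof.
move=> oU sf Ua e0.
have cD : {for a, continuous ('D_w ('D_v f))}.
  exact/differentiable_continuous/(sf [:: w; v]).
have : \forall y \near a, U y /\ `|'D_w ('D_v f) a - 'D_w ('D_v f) y| < e.
  apply: filterI; first exact: open_nbhs_nbhs.
  by move/cvgrPdist_lt : cD; apply.
move=> /nbhs_ballP[r /= r0 br].
near=> h.
have hP s t : s \in `[0, 1] -> t \in `[0, 1] ->
    ball a r (t *: (h *: w) + (s *: (h *: v) + a)).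
  by move: s t; near: h; exact: ball_parallelogram.
have [|s [t [sI tI ->]]] := @second_difference U f a (h *: v) (h *: w) sf.
  by move=> s t sI tI; have [] := br _ (hP s t sI tI).
have [Uy ye] := br _ (hP s t sI tI).
set y := _ + _ in Uy ye *.
have -> : 'D_(h *: w) ('D_(h *: v) f) y = h ^+ 2 * 'D_w ('D_v f) y.
  rewrite (smooth_on_scale_derive h w (smooth_on_derive (h *: v) sf) Uy).
  transitivity (h * (h * 'D_w ('D_v f) y)); last by rewrite mulrA.
  congr (_ * _).
  rewrite (@near_eq_derive _ _ _ _ (fun x => h * 'D_v f x)).
    apply: (@deriveMl _ _ ('D_v f)).
    exact/diff_derivable/(smooth_onW (smooth_on_derive v sf)).
  by near=> z; rewrite (smooth_on_scale_derive h v sf) //; near: z;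
    exact: open_nbhs_nbhs.
rewrite distrC in ye.
have {}ye := ltW ye.
move: ye; move: ('D_w _ y) ('D_w _ a) => p q pq.
rewrite -mulrBr normrM (ger0_norm (sqr_ge0 h)).
by apply: ler_wpM2l => //; exact: sqr_ge0.
Unshelve. all: by end_near. Qed.

Lemma deriveC U f a v w : open U -> smooth_on U f -> U a ->
  'D_v ('D_w f) a = 'D_w ('D_v f) a.
Proof.
move=> oU sf Ua; apply/eqP; rewrite -subr_eq0 -normr_le0.
apply/ler_addgt0Pr => e e0; rewrite add0r.
have e2 : 0 < e / 2 by rewrite divr_gt0.
have H1 := nbhs_dnbhs (second_difference_approx v w oU sf Ua e2).
have H2 := nbhs_dnbhs (second_difference_approx w v oU sf Ua e2).
have [h [[d1 d2] h0]] := filter_ex (filterI (filterI H1 H2)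
  (@nbhs_dnbhs_neq _ (0 : R))).
have {}h0 : h != 0 by exact: h0.
have h2 : 0 < h ^+ 2 by rewrite exprn_even_gt0.
(* Once the order of the increments is exchanged, [d1] and [d2] estimate the same second difference,
   each up to [h ^+ 2 * (e / 2)]. *)
rewrite (addrCA (h *: v)) in d2.
move: d1 d2; move: ('D_v _ a) ('D_w _ a) => A B d1 d2.
rewrite -(ler_pM2l h2) -{1}(ger0_norm (ltW h2)) -normrM mulrBr.
move: d1 d2; move: (f _) (f _) (f _) (f _) => x y z t.
rewrite !ler_norml; move: (h ^+ 2) => k; lra.
Qed.

End Schwarz.

(** * Iterated derivatives and the topology of the sphere *)

Section IterD.
Context {R : realType} {E : normedModType R}.
Implicit Types (U : set E) (f g : E -> R).

Lemma iterD_cat f vs ws : iterD (iterD f vs) ws = iterD f (ws ++ vs).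
Proof. by rewrite /iterD foldr_cat. Qed.

Lemma smooth_on_iterD U f vs : smooth_on U f -> smooth_on U (iterD f vs).
Proof. by move=> sf ws a Ua; rewrite iterD_cat; exact: sf. Qed.

Lemma smooth_on_subset U V f : V `<=` U -> smooth_on U f -> smooth_on V f.
Proof. by move=> VU sf vs a /VU; exact: sf. Qed.

Lemma smooth_on_continuous U f : smooth_on U f ->
  forall a, U a -> {for a, continuous f}.
Proof. by move=> sf a Ua; exact/differentiable_continuous/(smooth_onW sf). Qed.

Lemma iterD_eq U f g vs : open U -> (forall x, U x -> f x = g x) ->
  forall x, U x -> iterD f vs x = iterD g vs x.
Proof.
move=> oU fg; elim: vs => [|v vs IH] x Ux; first exact: fg.
apply: near_eq_derive; have : nbhs x U by exact: open_nbhs_nbhs.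
by apply: filterS => y; exact: IH.
Qed.

Lemma iterD_smoothB U f g (k : R) vs : open U -> smooth_on U f ->
  smooth_on U g -> forall x, U x ->
  iterD (fun y => k * (f y - g y)) vs x = k * (iterD f vs x - iterD g vs x).
Proof.
move=> oU sf sg; elim: vs => [//|v vs IH] x Ux /=.
have df : derivable (iterD f vs) x v by apply/diff_derivable/sf.
have dg : derivable (iterD g vs) x v by apply/diff_derivable/sg.
rewrite (@near_eq_derive _ _ _ _
  (fun y => k * ((iterD f vs : E -> R^o) - iterD g vs) y)).
  rewrite (@deriveMl _ _ ((iterD f vs : E -> R^o) - iterD g vs)); last first.
    exact: derivableB.
  by congr (_ * _); exact: deriveB.
have : nbhs x U by exact: open_nbhs_nbhs.
by apply: filterS => y; exact: IH.
Qed.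

(** Repeated use of [deriveC]. It serves to move a derivative in the parameter past the derivatives
    in the space variable that make up a jet. *)
Lemma iterD_deriveC U f v ws : open U -> smooth_on U f ->
  forall x, U x -> iterD ('D_v f) ws x = 'D_v (iterD f ws) x.
Proof.
move=> oU sf; elim: ws => [//|w ws IH] x Ux /=.
rewrite (deriveC v w oU (smooth_on_iterD ws sf) Ux).
apply: near_eq_derive; have : nbhs x U by exact: open_nbhs_nbhs.
by apply: filterS => y; exact: IH.
Qed.

End IterD.

Section ProductDerivatives.
Context {R : realType} {E F : normedModType R}.
Implicit Types (U : set E) (f : E * F -> R).

(** A difference quotient in the second variable alone is one along [(0, w)]. *)
Lemma iterD_pair f a (ws : seq F) :
  iterD (fun x => f (a, x)) ws =
  fun x => iterD f [seq (0 : E, w) | w <- ws] (a, x).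
Proof.
elim: ws => [//|w ws IH] /=; rewrite IH; apply/funext => x.
set g := iterD f _.
have EE : (fun h : R => h^-1 *: (g (a, h *: w + x) - g (a, x))) =
    (fun h : R => h^-1 *: (g (h *: ((0 : E), w) + (a, x)) - g (a, x))).
  apply/funext => h; congr (_ *: (g _ - _)).
  by apply: injective_projections => /=; rewrite ?scaler0 ?add0r.
by rewrite /derive /= EE.
Qed.

Lemma smooth_on_pair (W : set (E * F)) f a : smooth_on W f ->
  smooth_on [set x | W (a, x)] (fun x => f (a, x)).
Proof.
move=> sf ws x Wx; rewrite iterD_pair.
apply: (@differentiable_comp _ _ _ _ (fun x => (a, x)) (iterD f _)).
  apply: (@differentiable_pair _ _ _ _ (cst a) id).
    exact: differentiable_cst.
  exact: ex_diff.
exact: sf.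
Qed.

Lemma open_setM U (V : set F) : open U -> open V -> open (U `*` V).
Proof.
move=> oU oV; rewrite openE => -[a x] [/= Ua Vx].
by exists (U, V) => //=; split; exact: open_nbhs_nbhs.
Qed.

End ProductDerivatives.

(** * Compactness of the sphere and uniform convergence of jets *)

Section SphereTopology.
Context {R : realType} {N : nat}.
Implicit Types (x : 'cV[R]_N) (p : sphere R N).

(** The Euclidean square, as opposed to the sup norm which ['cV[R]_N] carries. *)
Definition sqnorm x : R := \sum_i x i ord0 ^+ 2.

Lemma sqnorm_ge0 x : 0 <= sqnorm x.
Proof. by apply: sumr_ge0 => i _; exact: sqr_ge0. Qed.

Lemma sqnorm_eq0 x : (sqnorm x == 0) = (x == 0).
Proof.
apply/idP/eqP => [|->]; last first.
  by apply/eqP/big1 => i _; rewrite mxE expr0n.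
rewrite psumr_eq0 => [/allP x0|i _]; last exact: sqr_ge0.
apply/colP => i; rewrite mxE; apply/eqP; rewrite -sqrf_eq0.
by have := x0 i (mem_index_enum i).
Qed.

Lemma sqnorm_gt0 x : x != 0 -> 0 < sqnorm x.
Proof. by move=> x0; rewrite lt_def sqnorm_eq0 x0 sqnorm_ge0. Qed.

Lemma sqnorm_sphere p : sqnorm p = 1.
Proof. by case: p => x /= /eqP. Qed.

Lemma sphere_neq0 p : (p : 'cV[R]_N) != 0.
Proof. by rewrite -sqnorm_eq0 sqnorm_sphere oner_eq0. Qed.

Definition normalize x := (Num.sqrt (sqnorm x))^-1 *: x.

Lemma sqnorm_normalize x : x != 0 -> sqnorm (normalize x) == 1.
Proof.
move=> x0; have n0 := sqnorm_gt0 x0.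
rewrite /sqnorm; under eq_bigr do rewrite mxE exprMn.
by rewrite -mulr_sumr exprVn sqr_sqrtr ?ltW// mulVf// gt_eqF.
Qed.

Lemma radialE (f : sphere R N -> R) (g : 'cV[R]_N -> R) x : x != 0 ->
  (forall p, f p = g p) -> radial f x = g (normalize x).
Proof.
move=> x0 fg; rewrite /radial.
by rewrite (insubT (fun y : 'cV[R]_N => sqnorm y == 1)
  (sqnorm_normalize x0))/= fg.
Qed.

Lemma smooth_alg_sqnorm (V : set 'cV[R]_N) : open V -> smooth_alg V sqnorm.
Proof.
move=> oV; apply: smooth_alg_sum => // i.
by apply: (@smooth_algM _ _ _ (fun x => x i ord0) (fun x => x i ord0));
  apply: smooth_alg_base; exact: smooth_coord.
Qed.

Lemma open_neq0_col : open [set x : 'cV[R]_N | x != 0].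
Proof.
have -> : [set x : 'cV[R]_N | x != 0] = [set x | sqnorm x != 0].
  by apply/seteqP; split=> x /=; rewrite sqnorm_eq0.
by apply: smooth_alg_neq0; exact: smooth_alg_sqnorm openT.
Qed.

Lemma trmx_continuous m n : continuous (@trmx R m n).
Proof.
move=> /= M s /= /(nbhs_ballP (M^T)) [e e0 es].
apply/nbhs_ballP; exists e => //= P [_ MP]; apply: es; split=> // i j.
by rewrite !mxE.
Qed.

(** The sphere is closed and lies in a cube. The cube is compact as a set of row vectors and is
    carried to column vectors by transposition. *)
Lemma compact_sphere : compact [set x : 'cV[R]_N | sqnorm x = 1].
Proof.
pose I : set 'rV[R]_N := [set v | forall i, `[-1, 1]%classic (v ord0 i)].
have cI : compact I.
  apply: (@rV_compact R N (fun=> `[-1, 1]%classic)) => i.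
  exact: segment_compact.
have cT : compact (trmx @` I).
  apply: continuous_compact cI; apply: continuous_subspaceT.
  exact: trmx_continuous.
apply: subclosed_compact cT _.
  apply: (@closed_comp _ _ sqnorm [set y | y = 1]); last exact: closed_eq.
  move=> x _; apply: (smooth_on_continuous _ (Logic.I : setT x)).
  exact/(smooth_algP openT)/smooth_alg_sqnorm/openT.
move=> x /= x1; exists x^T; last by rewrite trmxK.
move=> i; rewrite /= mxE in_itv/= -ler_norml -sqrtr_sqr -[leRHS]sqrtr1.
rewrite ler_sqrt// -x1 /sqnorm (bigD1 i)//= lerDl.
by apply: sumr_ge0 => j _; exact: sqr_ge0.
Qed.

(** The tube lemma: by compactness, finitely many neighbourhoods of points of the sphere suffice,
    and the corresponding neighbourhoods of [a] can be intersected. *)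
Lemma near_sphere (T : topologicalType) (P : T -> 'cV[R]_N -> Prop) (a : T) :
  (forall p, \forall x \near (p : 'cV[R]_N) & b \near a, P b x) ->
  \forall b \near a, forall p, P b p.
Proof.
move=> H; have cov := iffLR (compact_near_coveringP _) compact_sphere.
apply: filterS (cov T (nbhs a) P _ _) => [b bP p|x /eqP x1].
  by apply: bP; exact: sqnorm_sphere.
exact: (H (Sphere x1)).
Qed.


Lemma cvg_Cinf_dist (F : set_system (Cinf R N)) (f : Cinf R N) : Filter F ->
  (forall ws (e : R), 0 < e ->
    \forall g \near F, forall p, `|jet f ws p - jet g ws p| < e) -> F --> f.
Proof.
move=> FF H; apply/cvg_CinfP => ws A /uniform_nbhs[B [+ BA]].
rewrite -entourage_ballE => -[e /= e0 eB].
apply: (filterS _ (H ws e e0)) => g fg; apply: BA => p _; exact/eB/fg.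
Qed.

End SphereTopology.

(** * Families of smooth functions on the sphere *)

Section Slices.
Context {R : realType} {E : normedModType R} {N : nat}.
Implicit Types (f : E * 'cV[R]_N -> R) (U : set E).

(* [slice f a] is 0 when [f (a, _)] is not smooth on the sphere. *)
Definition slice f (a : E) : Cinf R N :=
  insubd 0 (fun p : sphere R N => f (a, p : 'cV[R]_N)).

(* Degree 0 homogeneity: [f (a, _)] is then the radial extension of its
   restriction to the sphere, on which [jet] is computed. *)
Definition homogeneous f := forall a x, x != 0 -> f (a, normalize x) = f (a, x).

Definition smooth_family U f :=
  smooth_on (U `*` [set x : 'cV[R]_N | x != 0]) f /\ homogeneous f.

(** Homogeneity survives because the increment [(v, 0)] leaves [x] fixed, so the quotients at [x]
    and at [normalize x] agree. *)
Lemma smooth_family_derive U f v :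
  smooth_family U f -> smooth_family U ('D_(v, 0) f).
Proof.
move=> [sf hf]; split=> [|a x x0]; first exact: smooth_on_derive.
have EE : (fun h : R => h^-1 *:
      (f (h *: (v, (0 : 'cV[R]_N)) + (a, normalize x)) - f (a, normalize x))) =
    (fun h : R => h^-1 *: (f (h *: (v, (0 : 'cV[R]_N)) + (a, x)) - f (a, x))).
  apply/funext => h; congr (_ *: (_ - _)); last exact: hf.
  have pE y : h *: (v, (0 : 'cV[R]_N)) + (a, y) = (h *: v + a, y).
    by apply: injective_projections => /=; rewrite ?scaler0 ?add0r.
  by rewrite !pE; exact: hf.
by rewrite /derive /= EE.
Qed.

Lemma sliceE U f a : smooth_family U f -> U a ->
  forall p, slice f a p = f (a, p : 'cV[R]_N).
Proof.
move=> [sf _] Ua p; rewrite /slice insubdK//; apply/asboolP => q.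
exists [set x | x != 0], (fun x => f (a, x)); split=> //.
- exact: open_neq0_col.
- exact: sphere_neq0.
- by apply: smooth_on_subset (smooth_on_pair (a := a) sf) => x x0.
Qed.

Lemma sphere_punctured U a (p : sphere R N) : U a ->
  (U `*` [set x : 'cV[R]_N | x != 0]) (a, p : 'cV[R]_N).
Proof. by move=> Ua; split=> //; exact: (sphere_neq0 p). Qed.

(** Away from the origin, homogeneity identifies the radial extension of the slice with [f (a, _)],
    so jets become partial derivatives of [f]. *)
Lemma jet_slice U f a ws p : smooth_family U f -> U a ->
  jet (slice f a) ws p = iterD f [seq (0 : E, w) | w <- ws] (a, p : 'cV[R]_N).
Proof.
move=> sf Ua; transitivity (iterD (fun x => f (a, x)) ws p).
  2: by rewrite iterD_pair.
apply: (iterD_eq ws open_neq0_col) (sphere_neq0 p) => x x0.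
rewrite (@radialE _ _ (slice f a) (fun y => f (a, y)) _ x0); first exact: sf.2.
exact: sliceE sf Ua.
Qed.

Lemma near_slice f a (e : R) : 0 < e ->
  (forall p : sphere R N, {for (a, p : 'cV[R]_N), continuous f}) ->
  \forall b \near a, forall p : sphere R N,
    `|f (a, p : 'cV[R]_N) - f (b, p : 'cV[R]_N)| < e.
Proof.
move=> e0 cf.
(* Near [p], both [f (a, x)] and [f (b, x)] are compared with [f (a, p)], at a cost of [e / 2]
   each. *)
have e2 : 0 < e / 2 by rewrite divr_gt0.
apply: (@near_sphere _ _ _ (fun b x => `|f (a, x) - f (b, x)| < e)) => p.
have /cvgrPdist_lt/(_ _ e2) [[A B] /= [Aa Bp] AB] := cf p.
exists (B, A) => //= -[x b] /= [Bx Ab].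
have d1 := AB (b, x) (conj Ab Bx).
have d2 := AB (a, x) (conj (nbhs_singleton Aa) Bx).
move: d1 d2 => /=; move: (f _) (f _) (f _) => y z t.
by rewrite !ltr_norml => /andP[? ?] /andP[? ?]; apply/andP; split; lra.
Qed.

Lemma slice_continuous U f a : open U -> smooth_family U f -> U a ->
  {for a, continuous (slice f)}.
Proof.
move=> oU sf Ua; apply: cvg_Cinf_dist => ws e e0.
have oW := open_setM oU (@open_neq0_col R N).
have cg (p : sphere R N) : {for (a, p : 'cV[R]_N),
    continuous (iterD f [seq (0 : E, w) | w <- ws])}.
  apply: (smooth_on_continuous (smooth_on_iterD _ sf.1)).
  exact: (sphere_punctured p Ua).
have nU : nbhs a U by exact: open_nbhs_nbhs.
apply: filterS2 (near_slice e0 cg) nU => b db Ub p.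
by rewrite !(jet_slice _ _ sf).
Qed.

(** Fix [ws] and let [g] be the derivative of [f] along the vectors [(0, w)]. By the mean value
    theorem, the jet of the quotient is ['D_(v, 0) g] at a parameter between [a] and [h *: v + a].
    By [near_slice] this is close, for all [p] at once, to the value at [a], which is the jet of the
    limit by symmetry of derivatives. *)
Lemma slice_derive U f a v : open U -> smooth_family U f -> U a ->
  (fun h : R => h^-1 *: (slice f (h *: v + a) - slice f a)) @ 0^' -->
    slice ('D_(v, 0) f) a.
Proof.
move=> oU sf Ua; apply: cvg_Cinf_dist => ws e e0.
have sfv := smooth_family_derive v sf.
have oW := open_setM oU (@open_neq0_col R N).
have sg := smooth_on_iterD [seq (0 : E, w) | w <- ws] sf.1.
set g := iterD f _ in sg.
have cg (p : sphere R N) : {for (a, p : 'cV[R]_N), continuous ('D_(v, 0) g)}.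
  apply: (smooth_on_continuous (smooth_on_derive (v, 0) sg)).
  exact: (sphere_punctured p Ua).
have nU : nbhs a U by exact: open_nbhs_nbhs.
have nG : nbhs a (U `&` [set b | forall p : sphere R N,
    `|'D_(v, 0) g (a, p : 'cV[R]_N) - 'D_(v, 0) g (b, p : 'cV[R]_N)| < e]).
  by apply: filterI => //; exact: (near_slice e0 cg).
have /nbhs_ballP[r /= r0 br] := nG.
(* A parallelogram with one zero side is a segment from [a] to [h *: v + a]. *)
have bp := nbhs_dnbhs (@ball_parallelogram _ _ a 0 v r r0).
have : \forall h \near (0 : R)^', (forall s t : R,
    s \in `[0, 1] -> t \in `[0, 1] ->
    ball a r (t *: (h *: v) + (s *: (h *: 0) + a))) /\ h != 0.
  by apply: filterI => //; exact: (@nbhs_dnbhs_neq _ (0 : R)).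
apply: filterS => h [bh h0] p.
have {}bh (s : R) : s \in `[0, 1] -> ball a r (s *: (h *: v) + a).
  move=> sI; have /(_ 0 s) := bh.
  by rewrite scale0r add0r in_itv/= lexx ler01 => /(_ isT sI).
have Uh : U (h *: v + a).
  have [|+ _] := br (h *: v + a); last exact.
  by rewrite -[h *: v]scale1r; apply: bh; rewrite in_itv/= lexx ler01.
rewrite (jet_slice _ _ sfv Ua).
rewrite (iterD_deriveC _ _ oW sf.1 (sphere_punctured p Ua)).
rewrite -/g.
have -> : jet (h^-1 *: (slice f (h *: v + a) - slice f a)) ws p =
    h^-1 * (g (h *: v + a, p : 'cV[R]_N) - g (a, p : 'cV[R]_N)).
  transitivity (iterD (fun x => h^-1 * (f (h *: v + a, x) - f (a, x))) ws p).
    apply: (iterD_eq ws open_neq0_col) (sphere_neq0 p) => x x0.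
    rewrite (@radialE _ _ _
      (fun y => h^-1 * (f (h *: v + a, y) - f (a, y))) _ x0).
      by rewrite !sf.2.
    by move=> q; rewrite -(sliceE sf Uh) -(sliceE sf Ua).
  have ss b : U b -> smooth_on [set x : 'cV[R]_N | x != 0] (fun x => f (b, x)).
    move=> Ub; apply: smooth_on_subset (smooth_on_pair (a := b) sf.1) => x x0.
    by split.
  rewrite (iterD_smoothB _ _ open_neq0_col (ss _ Uh) (ss _ Ua) (sphere_neq0 p)).
  by rewrite !iterD_pair.
have pE (s : R) : s *: (h *: (v, 0)) + (a, p : 'cV[R]_N) =
    (s *: (h *: v) + a, p : 'cV[R]_N).
  by apply: injective_projections => /=; rewrite ?scaler0 ?add0r.
have Ws (s : R) : s \in `[0, 1] -> (U `*` [set x : 'cV[R]_N | x != 0])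
    (s *: (h *: (v, 0)) + (a, p : 'cV[R]_N)).
  move=> sI; rewrite pE; apply: (@sphere_punctured _ (s *: (h *: v) + a)).
  by have [] := br _ (bh s sI).
have [s sI|s sI] := @MVT_line _ _ g (a, p : 'cV[R]_N) (h *: (v, 0)).
  exact/(smooth_onW sg)/Ws.
rewrite (smooth_on_scale_derive h (v, 0) sg (Ws s sI)) pE.
have -> : h *: (v, 0) + (a, p : 'cV[R]_N) = (h *: v + a, p : 'cV[R]_N).
  by apply: injective_projections => /=; rewrite ?scaler0 ?add0r.
move=> ->; rewrite mulKf//.
by have [_] := br _ (bh s sI); exact.
Qed.

(** Derivatives of [f] along the parameter vectors [(v, 0)] are again smooth families; their slices
    are the required iterated derivatives. *)
Lemma smooth_into_slice U f : open U -> smooth_family U f ->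
  smooth_into U (slice f).
Proof.
move=> oU sf; exists (fun vs => slice (iterD f [seq (v, 0) | v <- vs])).
have sfD vs : smooth_family U (iterD f [seq (v, 0) | v <- vs]).
  by elim: vs => [//|v vs IH] /=; exact: smooth_family_derive.
split=> // vs a Ua; split; first exact: slice_continuous (sfD vs) Ua.
by move=> v; exact: slice_derive oU (sfD vs) Ua.
Qed.

End Slices.

(** * Smoothness of logarithms and square roots *)

Section LogSqrt.
Context {R : realType} {E : normedModType R} (V : set E).
Hypothesis oV : open V.
Implicit Types f g : E -> R.

Lemma is_derive_real_comp (u : R -> R) (du : R) f a v : differentiable f a ->
  is_derive (f a) 1 u du ->
  differentiable (u \o f) a /\ 'D_v (u \o f) a = du * 'D_v f a.
Proof.
move=> df Du; have du' : differentiable u (f a).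
  by apply/derivable1_diffP; exact: ex_derive.
split; first exact: differentiable_comp.
rewrite deriveE; last exact: differentiable_comp.
rewrite diff_comp//= diff1E//= derive1E derive_val -deriveE//.
exact: mulrC.
Qed.

(** Adding [ln \o f] to the class [smooth_alg] keeps it stable under derivation, because the
    derivative of [ln \o f] is a quotient in that class. *)
Lemma smooth_on_ln f : smooth_on V f -> (forall a, V a -> 0 < f a) ->
  smooth_on V (@ln R \o f).
Proof.
move=> sf f0.
apply: (@smooth_on_coind _ _ _
  (fun g => smooth_alg V g \/ g = @ln R \o f)) => //; last by right.
have df := smooth_onW sf.
move=> g [/(smooth_alg_step oV)[dg Dg]|->].
  by split=> // v; have [g' sg' gE] := Dg v; exists g' => //; left.
have Dln a v (Va : V a) :=
  is_derive_real_comp v (df a Va) (is_derive1_ln (f0 a Va)).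
split=> [a Va|v]; first by have [] := Dln a 0 Va.
exists ((fun a => (f a)^-1) \* 'D_v f).
  left; apply: smooth_algM; last exact/smooth_alg_base/smooth_on_derive.
  apply: smooth_algV; first exact: smooth_alg_base.
  by move=> a Va; rewrite gt_eqF// f0.
by move=> a Va; have [_ ->] := Dln a v Va.
Qed.

(** The products of a function [h] of [smooth_alg] with the root of [f] are stable under derivation:
    [h] is replaced by [h' + h * f' / (2 * f)]. *)
Lemma smooth_on_sqrt f : smooth_on V f -> (forall a, V a -> 0 < f a) ->
  smooth_on V (@Num.sqrt R \o f).
Proof.
move=> sf f0.
apply: (@smooth_on_coind _ _ _ (fun g => exists2 h, smooth_alg V h &
  g = h \* (@Num.sqrt R \o f))) => //; last first.
  exists (cst 1); first exact: smooth_alg_cst.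
  by apply/funext => x /=; rewrite mul1r.
have df := smooth_onW sf.
have Dsqrt a v (Va : V a) :=
  is_derive_real_comp v (df a Va) (is_derive1_sqrt (f0 a Va)).
move=> _ [h sh ->]; have [dh Dh] := smooth_alg_step oV sh.
have ds a : V a -> differentiable (@Num.sqrt R \o f) a.
  by move=> Va; have [] := Dsqrt a 0 Va.
split=> [a Va|v]; first by apply: differentiableM; [exact: dh|exact: ds].
have [h' sh' h'E] := Dh v.
exists ((h' \+ (h \* (cst 2^-1 \* ('D_v f \* (fun a => (f a)^-1))))) \*
    (@Num.sqrt R \o f)).
  eexists; last by [].
  apply: smooth_algD => //; apply: smooth_algM => //.
  apply: smooth_algM; first exact: smooth_alg_cst.
  apply: smooth_algM; first exact/smooth_alg_base/smooth_on_derive.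
  apply: smooth_algV; first exact: smooth_alg_base.
  by move=> a Va; rewrite gt_eqF// f0.
move=> a Va; rewrite deriveM; last 2 first.
- exact/diff_derivable/dh.
- exact/diff_derivable/ds.
have [_ ->] := Dsqrt a v Va; rewrite h'E//= /GRing.scale/=.
have s0 : Num.sqrt (f a) != 0 by rewrite sqrtr_eq0 -ltNge f0.
(* With [f a] written as the square of its root, the identity is rational in that root. *)
have -> : (f a)^-1 = (Num.sqrt (f a) ^+ 2)^-1 by rewrite sqr_sqrtr// ltW// f0.
by field.
Qed.
End LogSqrt.

Section Family.
Context {R : realType} {E : normedModType R} {N : nat}.
Implicit Types (f : E * 'cV[R]_N -> R) (U : set E).

Lemma normalize_id (x : 'cV[R]_N) : x != 0 ->
  normalize (normalize x) = normalize x.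
Proof.
move=> /sqnorm_normalize/eqP n1.
by rewrite {1}/normalize n1 sqrtr1 invr1 scale1r.
Qed.

Lemma normalize_sphere (p : sphere R N) : normalize p = p.
Proof. by rewrite /normalize sqnorm_sphere sqrtr1 invr1 scale1r. Qed.

(** For a conformal factor [f], this is the neighbourhood of the embedded group to which the
    logarithmic cocycle extends. *)
Definition positive_locus f : set E :=
  [set a | forall p : sphere R N, 0 < f (a, p : 'cV[R]_N)].

Lemma open_positive_locus f : smooth_family setT f -> open (positive_locus f).
Proof.
move=> [sf _]; rewrite openE => a fa.
apply: (@near_sphere _ _ _ (fun b x => 0 < f (b, x))) => p.
have cf : {for (a, p : 'cV[R]_N), continuous f}.
  apply: (smooth_on_continuous sf); exact: sphere_punctured.
have := cf _ (lt_nbhsr (fa p)) => -[[A B] /= [Aa Bp] AB].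
by exists (B, A) => //= -[x b] /= [Bx Ab]; exact: (AB (b, x)).
Qed.

Lemma smooth_family_ln f : smooth_family setT f ->
  smooth_family (positive_locus f) (@ln R \o f).
Proof.
move=> sf; have [sf1 hf] := sf; split=> [|a x x0 /=]; last by rewrite hf.
apply: smooth_on_ln.
- apply: open_setM; first exact: open_positive_locus.
  exact: open_neq0_col.
- by apply: smooth_on_subset sf1 => -[a x] [].
(* Homogeneity transfers positivity from the sphere to every nonzero [x]. *)
- move=> [a x] [/= fa x0]; rewrite -hf//.
  exact: (fa (Sphere (sqnorm_normalize x0))).
Qed.

Lemma smooth_on_linear (l : E -> R) (V : set E) : open V -> linear l ->
  continuous l -> smooth_on V l.
Proof.
move=> oV ll cl.
pose lM := GRing.isLinear.Build _ _ _ _ _ ll.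
pose L : {linear E -> R^o} := HB.pack (l : E -> R^o) lM.
apply: (@smooth_on_coind _ _ _ (fun g => g = l \/ exists c, g = cst c)) => //;
  last by left.
move=> _ [->|[c ->]]; split=> [a _|v].
- exact: (@linear_differentiable _ _ _ L).
- exists (cst (l v)); first by right; exists (l v).
  move=> a _; rewrite deriveE; last exact: (@linear_differentiable _ _ _ L).
  by rewrite (@diff_lin _ _ _ L).
- exact: differentiable_cst.
- by exists (cst 0); [right; exists 0|move=> a _; rewrite derive_cst].
Qed.

End Family.

(** * Isometries of the Lorentzian form *)

Section Isometries.
Context (F : numFieldType) (c : {rmorphism F -> F}) (m : nat).

Lemma Jform_involutive : Jform F m *m Jform F m = 1%:M.
Proof.
rewrite /Jform mulmx_block !mulmx0 !mul0mx mulmxN mulNmx !mulmx1 opprK.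
by rewrite addr0 !add0r -scalar_mx_block.
Qed.

(** Since J squares to 1, multiplying [sisoJ] by J on the left shows that the right-hand side is a
    left inverse of [g]. *)
Lemma siso_invE (g : siso c m) :
  siso_val (g^-1)%g = Jform F m *m adj c g *m Jform F m.
Proof.
have gJ : (Jform F m *m adj c g *m Jform F m) *m g = 1%:M.
  by rewrite -!mulmxA (mulmxA (adj c g)) sisoJ Jform_involutive.
by rewrite -[RHS]mulmx1 -(mulmxV (siso_unit g)) mulmxA gJ mul1mx.
Qed.

(** The lift of [proj_act h v] is [h *m lift1 v] divided by [last_coord h v]; it remains to apply
    [g] and read the last coordinate. *)
Lemma last_coordM (g h : 'M[F]_(m + 1)) v : last_coord h v != 0 ->
  last_coord (g *m h) v = last_coord g (proj_act h v) * last_coord h v.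
Proof.
move=> t0.
have lE : lift1 (proj_act h v) = (last_coord h v)^-1 *: (h *m lift1 v).
  rewrite -[h *m lift1 v]vsubmxK scale_col_mx; congr col_mx.
  by apply/matrixP => i j; rewrite !ord1 [RHS]mxE mxE eqxx mulVf.
rewrite [in RHS]/last_coord lE -scalemxAr mulmxA linearZ/= [X in X * _]mxE.
by rewrite mulrAC -/(last_coord h v) mulVf// mul1r.
Qed.

Lemma siso_last_coordM (g h : siso c m) v : last_coord (g^-1)%g v != 0 ->
  last_coord ((g * h)^-1)%g v =
  last_coord (h^-1)%g (proj_act (g^-1)%g v) * last_coord (g^-1)%g v.
Proof.
have -> : ((g * h)^-1)%g = (h^-1 * g^-1)%g by exact: invgM.
exact: last_coordM.
Qed.

End Isometries.

(** * A Lorentz boost fixing a point of the sphere *)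

Section Boost.
Context (F : numFieldType) (c : {rmorphism F -> F}) (n : nat).

Let e : 'cV[F]_n.+1 := delta_mx ord0 ord0.

(* A hyperbolic rotation in the plane of the first and last coordinates, with
   cosh = 5/4 and sinh = 3/4. It is squared in [boost] because an isometry
   obviously satisfies det^2 = 1, whereas det = 1 needs a computation. *)
Definition boost_sqrt : 'M[F]_(n.+1 + 1) :=
  block_mx (1%:M + 4^-1 *: (e *m e^T)) ((3 / 4) *: e)
           ((3 / 4) *: e^T) (5 / 4)%:M.

Let B := boost_sqrt.

Lemma etr_e : e^T *m e = 1%:M.
Proof.
rewrite trmx_delta mul_delta_mx; apply/matrixP => i j.
by rewrite !ord1 !mxE.
Qed.

Lemma adj_boost_sqrt : adj c B = B.
Proof.
have ce p q (i : 'I_p) (j : 'I_q) : map_mx c (delta_mx i j) = delta_mx i j.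
  by apply/matrixP => k l; rewrite !mxE rmorph_nat.
have c4 : c 4^-1 = 4^-1 by rewrite fmorphV rmorph_nat.
have c34 : c (3 / 4) = 3 / 4 by rewrite rmorphM/= c4 rmorph_nat.
have c54 : c (5 / 4) = 5 / 4 by rewrite rmorphM/= c4 rmorph_nat.
rewrite /adj map_block_mx tr_block_mx; congr block_mx.
- rewrite map_mxD map_mx1 map_mxZ map_mxM -map_trmx ce c4.
  by rewrite linearD linearZ/= trmx_mul trmxK trmx1.
- by rewrite map_mxZ -map_trmx ce c34 linearZ/= trmxK.
- by rewrite map_mxZ ce c34 linearZ.
- by rewrite map_scalar_mx/= c54 tr_scalar_mx.
Qed.

(** [B] is self-adjoint, so this is the isometry condition. As [e *m e^T] is idempotent, the blocks
    reduce to scalar identities such as 25/16 - 9/16 = 1. *)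
Lemma boost_sqrtJ : B *m Jform F n.+1 *m B = Jform F n.+1.
Proof.
have eeT : e *m e^T *m (e *m e^T) = e *m e^T.
  by rewrite mulmxA -(mulmxA e) etr_e mulmx1.
have eee : e *m e^T *m e = e by rewrite -mulmxA etr_e mulmx1.
have eTee : e^T *m (e *m e^T) = e^T by rewrite mulmxA etr_e mul1mx.
rewrite /B /boost_sqrt /Jform !mulmx_block !mulmx0 !mulmxN !mulmx1.
rewrite !addr0 !add0r; congr block_mx.
- rewrite mulmxDl mul1mx mulmxDr mulmx1 mulNmx -!scalemxAl -!scalemxAr eeT.
  by move: (e *m _) => P; apply/matrixP => i j; rewrite !mxE; field.
- rewrite mulmxDl mul1mx mulNmx -!scalemxAl -!scalemxAr eee mul_mx_scalar.
  by move: (e) => u; apply/matrixP => i j; rewrite !mxE; field.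
- rewrite mulNmx mulmxDr mulmx1 -!scalemxAl -!scalemxAr eTee mul_scalar_mx.
  by move: (e^T) => u; apply/matrixP => i j; rewrite !mxE; field.
- rewrite mulNmx -!scalemxAl -!scalemxAr etr_e mul_scalar_mx.
  by apply/matrixP => i j; rewrite !mxE !ord1/=; field.
Qed.

Fact boost_subproof :
  (adj c (B *m B) *m Jform F n.+1 *m (B *m B) == Jform F n.+1) &&
  (\det (B *m B) == 1).
Proof.
apply/andP; split.
  rewrite adjM adj_boost_sqrt -!mulmxA (mulmxA (Jform _ _)).
  by rewrite (mulmxA B (_ *m B) B) (mulmxA B (Jform _ _))
    boost_sqrtJ mulmxA boost_sqrtJ.
have dJ : \det (Jform F n.+1) != 0.
  apply/eqP => J0; have := congr1 determinant (Jform_involutive F n.+1).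
  by rewrite det_mulmx J0 mul0r det1 => /esym/eqP; rewrite oner_eq0.
(* The square of the determinant of [B] comes out multiplied by that of J, which cancels. *)
have := congr1 determinant boost_sqrtJ; rewrite !det_mulmx mulrAC => dB.
by apply/eqP/(mulIf dJ); rewrite mul1r.
Qed.

Definition boost : siso c n.+1 := Siso boost_subproof.

Lemma boost_lift1 : boost *m lift1 e = 4 *: lift1 e.
Proof.
(* [(e, 1)] spans an isotropic eigenline, with eigenvalue cosh + sinh = 5/4 + 3/4 = 2. *)
have Be : B *m lift1 e = 2 *: lift1 e.
  rewrite /B /boost_sqrt /lift1 mul_block_col !mulmx1 scale_col_mx.
  rewrite mulmxDl mul1mx -!scalemxAl -mulmxA etr_e mulmx1.
  congr col_mx.
    by move: (e) => u; apply/matrixP => i j; rewrite !mxE; field.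
  by apply/matrixP => i j; rewrite !mxE !ord1/=; field.
rewrite /= -mulmxA Be -scalemxAr Be scalerA; congr (_ *: _); ring.
Qed.

Lemma boost_last_coord : last_coord boost e = 4.
Proof.
by rewrite /last_coord boost_lift1 linearZ/= col_mxKd !mxE eqxx mulr1.
Qed.

Lemma boost_proj_act : proj_act boost e = e.
Proof.
rewrite /proj_act boost_last_coord boost_lift1 linearZ/= col_mxKu scalerA.
by rewrite mulVf ?scale1r// pnatr_eq0.
Qed.

End Boost.

(** * Conformal factors *)

Section Entries.
Context (T : Type) (F : numFieldType) (A : (T -> F) -> Prop).
Hypothesis A_cst : forall a, A (cst a).
Hypothesis A_add : forall f h, A f -> A h -> A (f \+ h).
Hypothesis A_mul : forall f h, A f -> A h -> A (f \* h).

(** Smoothness is abstracted to a class [A] containing the constants and closed under sums and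
    products, so as to cover both [smooth_alg] and [csmooth_alg]. *)
Definition entrywise p q (g : T -> 'M[F]_(p, q)) :=
  forall i j, A (fun x => g x i j).

Lemma entrywise_mul p q r (g : T -> 'M[F]_(p, q)) (h : T -> 'M[F]_(q, r)) :
  entrywise g -> entrywise h -> entrywise (fun x => g x *m h x).
Proof.
move=> Ag Ah i j.
have -> : (fun x => (g x *m h x) i j) =
    \sum_k ((fun x => g x i k) \* (fun x => h x k j)).
  by apply/funext => x; rewrite fct_sumE mxE.
elim/big_ind : _ => [|f1 f2|k _]; [exact: A_cst|exact: A_add|exact: A_mul].
Qed.

Lemma entrywise_last_coord m (g : T -> 'M[F]_(m + 1)) (v : T -> 'cV[F]_m) :
  entrywise g -> entrywise v -> A (fun x => last_coord (g x) (v x)).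
Proof.
move=> Ag Av.
have -> : (fun x => last_coord (g x) (v x)) =
    (fun x => (g x *m lift1 (v x)) (rshift m ord0) ord0).
  by apply/funext => x; rewrite /last_coord mxE.
apply: entrywise_mul => // j k; rewrite ord1.
rewrite /lift1 -(splitK j); case: (fintype.split j) => i /=.
  have -> : (fun x => col_mx (v x) 1%:M (lshift 1 i) ord0) =
    (fun x => v x i ord0) by apply/funext => x; rewrite col_mxEu.
  exact: Av.
have -> : (fun x => col_mx (v x) 1%:M (rshift m i) ord0) =
  cst ((1%:M : 'M[F]_1) i ord0) by apply/funext => x; rewrite col_mxEd.
exact: A_cst.
Qed.

Lemma entrywise_conj_Jform m (g : T -> 'M[F]_(m + 1)) : entrywise g ->
  entrywise (fun x => Jform F m *m g x *m Jform F m).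
Proof.
move=> Ag; apply: entrywise_mul; [apply: entrywise_mul|] => // i j;
  exact: A_cst.
Qed.

End Entries.

Section ConformalFactors.
Context {R : realType}.

Section Coordinates.
Context {d N : nat} (W : set ('rV[R]_d * 'cV[R]_N)).
Hypothesis oW : open W.

Lemma smooth_alg_fst k : smooth_alg W (fun z => z.1 ord0 k).
Proof.
apply/smooth_alg_base/smooth_on_linear => //.
  by move=> a x y; rewrite !mxE.
move=> z; apply: (@continuous_comp _ _ _ fst (fun M : 'rV[R]_d => M ord0 k)).
  exact: cvg_fst.
exact: coord_continuous.
Qed.

Lemma smooth_alg_snd k : smooth_alg W (fun z => z.2 k ord0).
Proof.
apply/smooth_alg_base/smooth_on_linear => //.
  by move=> a x y; rewrite !mxE.
move=> z; apply: (@continuous_comp _ _ _ snd (fun M : 'cV[R]_N => M k ord0)).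
  exact: cvg_snd.
exact: coord_continuous.
Qed.

Lemma smooth_alg_normalize k : (forall z, W z -> z.2 != 0) ->
  smooth_alg W (fun z => normalize z.2 k ord0).
Proof.
move=> W0.
have sn : smooth_alg W (fun z => sqnorm z.2).
  apply: smooth_alg_sum => // i.
  exact: (smooth_algM (smooth_alg_snd i) (smooth_alg_snd i)).
have -> : (fun z : 'rV[R]_d * 'cV[R]_N => normalize z.2 k ord0) =
  (fun z => (Num.sqrt (sqnorm z.2))^-1) \* (fun z => z.2 k ord0).
  by apply/funext => z /=; rewrite mxE.
apply: smooth_algM; last exact: smooth_alg_snd.
apply: smooth_algV => [|z /W0 z0]; last first.
  by rewrite gt_eqF// sqrtr_gt0 sqnorm_gt0.
apply/smooth_alg_base/smooth_on_sqrt => //; first exact: smooth_algP.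
by move=> z /W0; exact: sqnorm_gt0.
Qed.

End Coordinates.

Variable m : nat.

(** The square of t, as t itself may be negative. Writing the inverse as J g^* J gives it a meaning
    for every matrix, and [normalize] makes it homogeneous of degree 0 in the point. *)
Definition SO_factor (z : 'rV[R]_((m + 1) * (m + 1)) * 'cV[R]_m) : R :=
  last_coord (Jform R m *m adj idfun (vec_mx z.1) *m Jform R m)
    (normalize z.2) ^+ 2.

Definition SU_unemb (a : 'rV[R]_((m + 1) * ((m + 1) + (m + 1)))) :
    'M[R[i]]_(m + 1) :=
  \matrix_(i, j) (lsubmx (vec_mx a) i j +i* rsubmx (vec_mx a) i j)%C.

Definition SU_factor
    (z : 'rV[R]_((m + 1) * ((m + 1) + (m + 1))) * 'cV[R]_(m + m)) : R :=
  sqmod (last_coord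
    (Jform R[i] m *m adj (@conjc R) (SU_unemb z.1) *m Jform R[i] m)
    (cplx (normalize z.2))).

Lemma smooth_family_SO_factor : smooth_family setT SO_factor.
Proof.
split=> [|a x x0]; last by rewrite /SO_factor/= normalize_id.
set W := _ `*` _; have oW : open W.
  by apply: open_setM; [exact: openT|exact: open_neq0_col].
apply: smooth_algP => //.
pose t (z : 'rV[R]_((m + 1) * (m + 1)) * 'cV[R]_m) := last_coord
  (Jform R m *m adj idfun (vec_mx z.1) *m Jform R m) (normalize z.2).
suff st : smooth_alg W t by exact: (smooth_algM st st).
have Ac a : smooth_alg W (cst a) by exact: smooth_alg_cst.
have Aa := @smooth_algD R _ W; have Am := @smooth_algM R _ W.
apply: entrywise_last_coord => //.
  apply: entrywise_conj_Jform => // i j.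
  under eq_fun do rewrite !mxE.
  exact: smooth_alg_fst.
move=> i j; rewrite ord1; apply: smooth_alg_normalize => //.
by move=> z [].
Qed.

Lemma smooth_family_SU_factor : smooth_family setT SU_factor.
Proof.
split=> [|a x x0]; last by rewrite /SU_factor/= normalize_id.
set W := _ `*` _; have oW : open W.
  by apply: open_setM; [exact: openT|exact: open_neq0_col].
apply: smooth_algP => //; apply: smooth_alg_sqmod.
have Ac a : csmooth_alg W (cst a) by exact: csmooth_alg_cst.
have Aa := @csmooth_algD R _ W; have Am := @csmooth_algM R _ W oW.
apply: entrywise_last_coord => //.
  apply: entrywise_conj_Jform => // i j; split.
    under eq_fun do rewrite !mxE/=.
    exact: smooth_alg_fst.
  (* The adjoint transposes, whence the index [j] before [i], and conjugation changes the sign of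
     the imaginary part. *)
  have sN := smooth_algM (smooth_alg_cst (-1) oW)
    (smooth_alg_fst oW (mxvec_index j (rshift (m + 1) i))).
  by under eq_fun do rewrite !mxE/= -mulN1r.
move=> i j; rewrite ord1; split.
  under eq_fun do rewrite mxE/=.
  by apply: smooth_alg_normalize => // z [].
under eq_fun do rewrite mxE/=.
by apply: smooth_alg_normalize => // z [].
Qed.

Lemma SO_factorE (g : SO R m) (p : sphere R m) :
  SO_factor (SO_emb g, p : 'cV[R]_m) = last_coord (g^-1)%g p ^+ 2.
Proof.
rewrite /SO_factor/= mxvecK normalize_sphere; congr (last_coord _ _ ^+ 2).
exact/esym/siso_invE.
Qed.

Lemma SU_embK (g : SU R m) : SU_unemb (SU_emb g) = g.
Proof.
apply/matrixP => i j; rewrite /SU_emb mxE mxvecK row_mxKl row_mxKr !mxE.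
by case: (siso_val g i j).
Qed.

Lemma SU_factorE (g : SU R m) (p : sphere R (m + m)) :
  SU_factor (SU_emb g, p : 'cV[R]_(m + m)) =
  sqmod (last_coord (g^-1)%g (cplx p)).
Proof.
rewrite /SU_factor/= SU_embK normalize_sphere; congr (sqmod (last_coord _ _)).
exact/esym/siso_invE.
Qed.

End ConformalFactors.

(** * The logarithmic cocycle *)

Section LogCocycle.
Context (R : realType) (d N : nat) (G : groupType) (emb : G -> 'rV[R]_d).
Context (move_pt : G -> sphere R N -> sphere R N).
Context (act : G -> Cinf R N -> Cinf R N).
Hypothesis actE : forall g f p, act g f p = f (move_pt (g^-1)%g p).
Context (f : 'rV[R]_d * 'cV[R]_N -> R).
Hypothesis smooth_f : smooth_family setT f.
Hypothesis f_gt0 : forall g (p : sphere R N), 0 < f (emb g, p : 'cV[R]_N).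
Hypothesis fM : forall g h (p : sphere R N), f (emb (g * h)%g, p : 'cV[R]_N) =
  f (emb h, move_pt (g^-1)%g p : 'cV[R]_N) * f (emb g, p : 'cV[R]_N).

Lemma emb_pow1 (a : 'I_1 -> G) : emb_pow emb a = emb (a ord0).
Proof. by apply/matrixP => i j; rewrite !ord1 mxE. Qed.

Definition log_cochain : cochain G (Cinf R N) 1 :=
  fun a => slice (@ln R \o f) (emb (a ord0)).

Lemma log_cochainE a p :
  log_cochain a p = ln (f (emb (a ord0), p : 'cV[R]_N)).
Proof.
by apply: (sliceE (smooth_family_ln smooth_f)) => q; exact: f_gt0.
Qed.

Lemma smooth_log_cochain : smooth_cochain emb log_cochain.
Proof.
move=> a; exists (positive_locus f), (slice (@ln R \o f)); split.
- exact: open_positive_locus.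
- by move=> q; rewrite emb_pow1; exact: f_gt0.
- apply: smooth_into_slice; first exact: open_positive_locus.
  exact: smooth_family_ln.
- by move=> b _; rewrite emb_pow1.
Qed.

Lemma cocycle_log_cochain : cocycles emb act log_cochain.
Proof.
split; first exact: smooth_log_cochain.
apply/funext => a; apply/val_inj/funext => p.
rewrite /cobound big_ord1 expr1 scaleN1r expr2 mulrNN mulr1 scale1r.
(* These are the terms a_0 . l(a_1), l(a_0 a_1) and l(a_0), where l is the cochain. *)
set u := act _ _; set v := log_cochain _; set w := log_cochain _.
suff E : (u p : R) - v p + w p = 0 by exact: E.
rewrite /u actE !log_cochainE /merge /drop_last /drop_first /=.
have -> : widen_ord (leqnSn 1) ord0 = ord0 by exact: val_inj.
rewrite fM lnM ?posrE ?f_gt0//.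
by rewrite opprD addrA subrr add0r addNr.
Qed.

Lemma cobound0E (l : cochain G (Cinf R N) 0) a p :
  cobound act l a p =
  l (drop_last a) (move_pt (a ord0)^-1%g p) - l (drop_last a) p.
Proof.
rewrite /cobound big_ord0 addr0 expr1 scaleN1r -actE.
(* Both sides are families over the empty type ['I_0]. *)
have -> : drop_first a = drop_last a by apply/funext => -[].
reflexivity.
Qed.

(** Its coboundary provides a member of [coboundaries], and hence of each coset. *)
Lemma smooth_cochain0 : smooth_cochain emb (fun=> 0 : Cinf R N) (r := 0).
Proof.
move=> a; exists setT, (fun=> 0); split=> //; first exact: openT.
exists (fun _ _ => 0); split=> // vs b _; split=> [|v].
  exact: (@cst_continuous _ (Cinf R N)).
under eq_fun do rewrite subrr scaler0.
exact: (@cvg_cst (Cinf R N)).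
Qed.

(** If the only class were zero, the coset of [log_cochain] would consist of coboundaries. These
    vanish at [(k, p)], which forces the logarithm of [f (emb k, p)] to be 0 and [f (emb k, p)] to
    be 1. *)
Lemma Hd1_neq0 k (p : sphere R N) :
  move_pt (k^-1)%g p = p -> f (emb k, p : 'cV[R]_N) != 1 ->
  Hd emb act (r := 1) <> [set coboundaries emb act (r := 1)].
Proof.
move=> kp fk H.
have cob0 b : coboundaries emb act (r := 1) b -> b (fun=> k) p = 0.
  by move=> [l _ <-]; rewrite cobound0E kp subrr.
pose b0 : cochain G (Cinf R N) 1 := cobound act (fun=> 0).
have cb0 : coboundaries emb act (r := 1) b0.
  by exists (fun=> 0) => //; exact: smooth_cochain0.
have : Hd emb act (r := 1)
    [set log_cochain \+ b | b in coboundaries emb act (r := 1)].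
  by exists log_cochain => //; exact: cocycle_log_cochain.
rewrite H => /= /seteqP[+ _].
move=> /(_ (log_cochain \+ b0) (ex_intro2 _ _ _ cb0 erefl)) /cob0 lb0.
have : (log_cochain (fun=> k) p : R) + b0 (fun=> k) p = 0 by exact: lb0.
rewrite (cob0 _ cb0) addr0 log_cochainE => /eqP.
by rewrite ln_eq0 ?f_gt0// (negbTE fk).
Qed.

End LogCocycle.


(** * Nonvanishing for both groups *)

Lemma sum_sqr_delta (F : numFieldType) m (k : 'I_m) :
  \sum_i `|(delta_mx k ord0 : 'cV[F]_m) i ord0| ^+ 2 = 1.
Proof.
rewrite (bigD1 k)//= big1 => [|i /negbTE ik].
  by rewrite !mxE !eqxx normr1 expr1n addr0.
by rewrite mxE ik normr0 expr0n.
Qed.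

Lemma sqmodM (R : realType) (x y : R[i]) : sqmod (x * y) = sqmod x * sqmod y.
Proof. by case: x y => [a b] [a' b']; rewrite /sqmod/=; ring. Qed.

Lemma sqmod_gt0 (R : realType) (x : R[i]) : (0 < sqmod x) = (x != 0).
Proof.
by rewrite lt_def sqmod_neq0 andb_idr// => _; rewrite addr_ge0// -expr2 sqr_ge0.
Qed.

Theorem corollary9 (R : realType) (n : nat) (hn : (1 <= n)%N) :
  Hd (@SU_emb R n.+1) (@SU_Cinf R n.+1) (r := 1) <>
    [set coboundaries (@SU_emb R n.+1) (@SU_Cinf R n.+1) (r := 1)] /\
  Hd (@SO_emb R n.+1) (@SO_Cinf R n.+1) (r := 1) <>
    [set coboundaries (@SO_emb R n.+1) (@SO_Cinf R n.+1) (r := 1)].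
Proof.
pose e0 (F : numFieldType) : 'cV[F]_n.+1 := delta_mx ord0 ord0.
split.
- have n0 (g : SU R n.+1) (p : sphere R (n.+1 + n.+1)) :
      last_coord (g^-1)%g (cplx p) != 0.
    exact: (proj_act_sphere (@conjcE R) (g^-1)%g (cplx_sphere p)).1.
  have p1 : \sum_i uncplx (e0 R[i]) i ord0 ^+ 2 == 1.
    have := sum_sqr_delta R[i] (@ord0 n).
    by rewrite -(uncplxK (delta_mx _ _)) cplx_sum => -[->].
  have ce : cplx (Sphere p1) = e0 R[i] by exact: uncplxK.
  pose k : SU R n.+1 := boost (@conjc R) n.
  (* Action and factor both involve the inverse of the group element, so the inverse of the boost is
     supplied. *)
  apply: (@Hd1_neq0 _ _ _ _ _ (@SU_act R n.+1) _ _ (@SU_factor R n.+1) _ _ _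
    (k^-1)%g (Sphere p1)).
  + by [].
  + exact: smooth_family_SU_factor.
  + by move=> g p; rewrite SU_factorE sqmod_gt0.
  + move=> g h p; rewrite !SU_factorE -sqmodM; congr sqmod.
    have -> : cplx (SU_act (g^-1)%g p) = proj_act (g^-1)%g (cplx p).
      exact: uncplxK.
    exact: siso_last_coordM (n0 g p).
  + rewrite invgK; apply: val_inj; rewrite /= uncplxK; congr uncplx.
    exact: (boost_proj_act (@conjc R)).
  (* The factor at the fixed point is the squared modulus of 4, that is 16. *)
  + rewrite SU_factorE invgK ce boost_last_coord.
    have -> : 4 = (4%:C)%C :> R[i] by rewrite rmorph_nat.
    by rewrite /sqmod/= mulr0 addr0 -natrM pnatr_eq1.
- have n0 (g : SO R n.+1) (p : sphere R n.+1) : last_coord (g^-1)%g p != 0.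
    exact: (proj_act_sphere (@idfunE R) (g^-1)%g (sphere_norm p)).1.
  have p1 : \sum_i e0 R i ord0 ^+ 2 == 1.
    rewrite -(sum_sqr_delta R (@ord0 n)); apply/eqP/eq_bigr => i _.
    by rewrite real_normK ?num_real.
  pose k : SO R n.+1 := boost idfun n.
  apply: (@Hd1_neq0 _ _ _ _ _ (@SO_act R n.+1) _ _ (@SO_factor R n.+1) _ _ _
    (k^-1)%g (Sphere p1)).
  + by [].
  + exact: smooth_family_SO_factor.
  + by move=> g p; rewrite SO_factorE exprn_even_gt0//=; exact: n0.
  + move=> g h p; rewrite !SO_factorE -exprMn; congr (_ ^+ 2).
    exact: siso_last_coordM (n0 g p).
  + by rewrite invgK; apply: val_inj; exact: (boost_proj_act idfun).
  + rewrite SO_factorE invgK boost_last_coord.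
    by rewrite -natrX pnatr_eq1.
Qed.
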